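(* Let $1\leq p<q<\infty$ and $\omega\in A^{\rho,\theta_2}_{p,q}(\mathbb R^d)$ with $0<\theta_2<\infty$, and let $0<\beta<1$. Then the following statements are true. (1) Let $0<\theta_1<\infty$. There is a constant $C>0$ such that for every $f\in \mathcal{C}^{\beta,\ast}_{\rho,\theta_1}(\mathbb R^d)$ and every ball $\mathcal{B}=B(x_0,r)$ in $\mathbb R^d$, $$\frac{1}{|\mathcal{B}|^{\beta/d}}\bigg(\frac{1}{\omega^q(\mathcal{B})}\int_{\mathcal{B}}\Big[f(x)-\operatorname*{ess\,inf}_{y\in\mathcal{B}}f(y)\Big]^q\omega(x)^q\,dx\bigg)^{1/q}\leq C[\omega]_{A^{\rho,\theta_2}_{p,q}}\bigg(1+\frac{r}{\rho(x_0)}\bigg)^{(N_0+1)\theta_1}\|f\|_{\mathcal{C}^{\beta,\ast}_{\rho,\theta_1}}.$$ (2) Conversely, let $f\in L^1_{\mathrm{loc}}(\mathbb R^d)$ be real-valued. If there exist a constant $C>0$ and some $\theta_1>0$ such that for any ball $\mathcal{B}=B(x_0,r)\subset\mathbb R^d$, $$\frac{1}{|\mathcal{B}|^{\beta/d}}\bigg(\frac{1}{\omega^q(\mathcal{B})}\int_{\mathcal{B}}\Big[f(x)-\operatorname*{ess\,inf}_{y\in\mathcal{B}}f(y)\Big]^q\omega(x)^q\,dx\bigg)^{1/q}\leq C[\omega]_{A^{\rho,\theta_2}_{p,q}}\bigg(1+\frac{r}{\rho(x_0)}\bigg)^{\theta_1-\theta_2},$$ then $f\in\mathcal{C}^{\beta,\ast}_{\rho,\theta_1}(\mathbb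 R^d)$ and $\|f\|_{\mathcal{C}^{\beta,\ast}_{\rho,\theta_1}}\leq C'[\omega]_{A^{\rho,\theta_2}_{p,q}}$, where $C'>0$ is a constant that may differ from $C$ (it may depend on $C$ and the fixed data $V,d,p,q,\beta,\omega,\theta_1,\theta_2$, but not otherwise on $f$).
   Context: Let $d\ge 3$ and let $V:\mathbb R^d\to[0,\infty)$ be locally integrable, $V\not\equiv 0$, belonging to the reverse Hölder class $RH_s(\mathbb R^d)$ for some $s\in(1,\infty]$ with $s\ge d/2$; that is, there is $C>0$ such that $\big(\frac1{|B|}\int_B V^s\,dy\big)^{1/s}\le C\,\frac1{|B|}\int_B V\,dy$ for every ball $B\subset\mathbb R^d$ (usual modification if $s=\infty$). The critical radius function is $\rho(x):=\sup\{r>0: r^{2-d}\int_{B(x,r)}V(y)\,dy\le 1\}$, and $0<\rho(x)<\infty$ for all $x$. The constants $C_0\ge1$ and $N_0>0$ are fixed constants such that $$\frac1{C_0}\Big(1+\frac{|x-y|}{\rho(x)}\Big)^{-N_0}\le\frac{\rho(y)}{\rho(x)}\le C_0\Big(1+\frac{|x-y|}{\rho(x)}\Big)^{\frac{N_0}{N_0+1}}\quad\text{for all }x,y\in\mathbb R^d$$ (such constants exist by a known result of Shen). $B(x_0,r)$ is the open ball with center $x_0\in\mathbb R^d$ and radius $r\in(0,\infty)$; $|E|$ is Lebesgue measure. For $0<\beta\le1$ and $0\le\theta<\infty$, a real-valued $f\in L^1_{\mathrm{loc}}(\mathbb R^d)$ belongs to $\mathcal{C}^{\beta,\ast}_{\rho,\theta}(\mathbb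 R^d)$ if $$\|f\|_{\mathcal{C}^{\beta,\ast}_{\rho,\theta}}:=\sup_{\mathcal B=B(x_0,r)}\Big(1+\frac r{\rho(x_0)}\Big)^{-\theta}\frac1{|\mathcal B|^{1+\beta/d}}\int_{\mathcal B}\Big[f(x)-\operatorname*{ess\,inf}_{y\in\mathcal B}f(y)\Big]dx<\infty,$$ the supremum being over all balls. A weight is a nonnegative locally integrable function $\omega$ on $\mathbb R^d$; for $\gamma>0$, $\omega^\gamma(E):=\int_E\omega(x)^\gamma\,dx$. With $p'=p/(p-1)$, the class $A^{\rho,\theta}_{p,q}(\mathbb R^d)$ consists of the weights $\omega$ with $[\omega]_{A^{\rho,\theta}_{p,q}}<\infty$, where for $1<p,q<\infty$ $$[\omega]_{A^{\rho,\theta}_{p,q}}:=\sup_{B=B(x_0,r)}\Big(1+\frac r{\rho(x_0)}\Big)^{-\theta}\Big(\frac1{|B|}\int_B\omega^q\,dx\Big)^{1/q}\Big(\frac1{|B|}\int_B\omega^{-p'}\,dx\Big)^{1/p'},$$ and for $p=1$, $1<q<\infty$ $$[\omega]_{A^{\rho,\theta}_{1,q}}:=\sup_{B=B(x_0,r)}\Big(1+\frac r{\rho(x_0)}\Big)^{-\theta}\Big(\frac1{|B|}\int_B\omega^q\,dx\Big)^{1/q}\Big(\operatorname*{ess\,inf}_{x\in B}\omega(x)\Big)^{-1},$$ the suprema being over all balls; all the averages and reciprocals in these expressions are understood to be finite (so $0<\omega<\infty$ a.e.). Constants $C$ in conclusions are positive and independent of $f$ and of the ball; they may depend on $V,d,p,q,\beta,\omega,\theta_1,\theta_2$.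 *)

(* Defs.v *)
From HB Require Import structures.
From mathcomp Require Import all_boot all_order all_algebra.
From mathcomp Require Import all_classical all_reals all_analysis.
From mathcomp Require Import ess_sup_inf.
Set Implicit Arguments.
Unset Strict Implicit.
Unset Printing Implicit Defensive.
Import Order.TTheory GRing.Theory Num.Theory.
Import numFieldNormedType.Exports.
Local Open Scope classical_set_scope.
Local Open Scope ring_scope.

(* Points of R^d are d-tuples with the product sigma-algebra of the library,
   i.e. the Borel sigma-algebra; Lebesgue measure on them is the iterated
   product of the one-dimensional one, transported along (a, u) |-> a :: u. *)
Section lebesgue_cons.
Context (R : realType) (n : nat).
Variable m : {sigma_finite_measure set (n.-tuple R) -> \bar R}.

Definition pair_cons (u : measurableTypeR R * n.-tuple R) : n.+1.-tuple R :=
  [tuple of u.1 :: u.2].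

Lemma measurable_pair_cons : measurable_fun setT pair_cons.
Proof.
have h : measurable_fun setT (fst : measurableTypeR R * n.-tuple R -> R).
  exact: measurable_fst.
exact: (@measurable_cons _ _ _ _ fst n snd h measurable_snd).
Qed.

Definition lebesgue_cons : set (n.+1.-tuple R) -> \bar R :=
  pushforward (lebesgue_measure \x m)%E pair_cons.

Let measurable_pre A : measurable A -> measurable (pair_cons @^-1` A).
Proof. by move=> mA; rewrite -[_ @^-1` _]setTI; exact: measurable_pair_cons. Qed.

Let lebesgue_cons0 : lebesgue_cons set0 = 0%E.
Proof. by rewrite /lebesgue_cons /pushforward preimage_set0 measure0. Qed.

Let lebesgue_cons_ge0 A : (0 <= lebesgue_cons A)%E.
Proof. by rewrite /lebesgue_cons /pushforward measure_ge0. Qed.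

Let lebesgue_cons_sigma_additive : semi_sigma_additive lebesgue_cons.
Proof.
move=> F mF tF mUF; rewrite /lebesgue_cons /pushforward preimage_bigcup.
apply: measure_semi_sigma_additive.
- by move=> i; exact: measurable_pre.
- apply/trivIsetP => /= i j _ _ ij; rewrite -preimage_setI.
  by move/trivIsetP : tF => /(_ _ _ _ _ ij) ->//; rewrite preimage_set0.
- by rewrite -preimage_bigcup; exact: measurable_pre.
Qed.

HB.instance Definition _ := isMeasure.Build _ _ _
  lebesgue_cons lebesgue_cons0 lebesgue_cons_ge0 lebesgue_cons_sigma_additive.

Let lebesgue_cons_sigma_finite : sigma_finite setT lebesgue_cons.
Proof.
have [F TF Foo] := sigma_finiteT (@lebesgue_measure R).
have [G TG Goo] := sigma_finiteT m.
pose tl (x : n.+1.-tuple R) : n.-tuple R := [tuple of behead x].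
have mthead : measurable_fun setT (@thead n R).
  exact: (@measurable_tnth _ R n.+1 ord0).
have mtl : measurable_fun setT tl by exact: measurable_behead.
pose H (p : nat * nat) := (@thead n R @^-1` F p.1) `&` (tl @^-1` G p.2).
exists (fun k => if @unpickle (nat * nat)%type k is Some p then H p else set0).
  apply/esym; rewrite -subTset => x _.
  have [i _ Fi] : (\bigcup_i F i) (thead x) by rewrite -TF.
  have [j _ Gj] : (\bigcup_i G i) (tl x) by rewrite -TG.
  by exists (pickle (i, j)) => //; rewrite pickleK.
move=> k; case: unpickle => [[i j]|]; last by rewrite measure0.
have [mF Fi] := Foo i; have [mG Gj] := Goo j.
have mH : measurable (H (i, j)).
  apply: measurableI.
  - by rewrite -[X in measurable X]setTI; exact: mthead.
  - by rewrite -[X in measurable X]setTI; exact: mtl.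
split=> //.
have -> : lebesgue_cons (H (i, j)) = (lebesgue_measure (F i) * m (G j))%E.
  rewrite -product_measure1E//; congr product_measure1.
  apply/seteqP; split => -[a b] /=; rewrite /H /= (_ : tl _ = b)//;
    exact/val_inj.
by rewrite lte_mul_pinfty// ge0_fin_numE.
Qed.

HB.instance Definition _ := @Measure_isSigmaFinite.Build _ _ _
  lebesgue_cons lebesgue_cons_sigma_finite.

End lebesgue_cons.

Fixpoint lebesgue_tuple (R : realType) (n : nat) :
    {sigma_finite_measure set (n.-tuple R) -> \bar R} :=
  if n is n'.+1 then lebesgue_cons (lebesgue_tuple R n') else \d_[tuple].

Section euclidean_space.
Context (R : realType) (d : nat).
Local Notation E := (d.-tuple R).
Local Notation mu := (lebesgue_tuple R d).
Implicit Types (x y : E) (r : R) (B : set E) (f w V rho : E -> R).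

Definition edist x y : R := Num.sqrt (\sum_(i < d) (tnth x i - tnth y i) ^+ 2).

Definition eball x r : set E := [set y | edist x y < r].

Definition loc_integrable f :=
  forall x r, 0 < r -> mu.-integrable (eball x r) (EFin \o f).

Local Open Scope ereal_scope.

Definition avg B (g : E -> \bar R) : \bar R := (mu B)^-1 * \int[mu]_(y in B) g y.

(* Extending by +oo (resp. -oo) off B makes the values there irrelevant. *)
Definition ess_inf_on B f : \bar R := ess_inf mu (patch (cst +oo) B (EFin \o f)).

Definition ess_sup_on B f : \bar R := ess_sup mu (patch (cst -oo) B (EFin \o f)).

(* Only used for 1 < s, so that the second branch is s = +oo. *)
Definition power_mean (s : \bar R) B f : \bar R :=
  if s is t%:E then (avg B (fun y => (f y `^ t)%:E)) `^ t^-1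
  else ess_sup_on B f.

Definition reverse_hoelder (s : \bar R) V :=
  exists2 C : R, (0 < C)%R & forall x r, (0 < r)%R ->
    power_mean s (eball x r) V <= C%:E * avg (eball x r) (EFin \o V).

(* The real supremum is meaningful because, for the potentials considered, the
   set is nonempty and bounded for every x; on an unbounded set it would be 0,
   which admissible_constants rules out. *)
Definition critical_radius V x : R :=
  sup [set r | (0 < r)%R /\
    (r `^ (2 - d%:R))%:E * \int[mu]_(y in eball x r) (V y)%:E <= 1].

Definition admissible_constants rho (C0 N0 : R) := forall x y,
  (C0^-1 * (1 + edist x y / rho x) `^ (- N0) <= rho y / rho x /\
   rho y / rho x <= C0 * (1 + edist x y / rho x) `^ (N0 / (N0 + 1)))%R.

Definition growth rho x r (theta : R) : \bar R :=
  ((1 + r / rho x) `^ theta)%R%:E.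

Definition osc_norm rho (beta theta : R) f : \bar R :=
  ereal_sup [set u | exists x r, (0 < r)%R /\
    let B := eball x r in
    u = growth rho x r (- theta) * (mu B `^ (1 + beta / d%:R))^-1 *
        \int[mu]_(y in B) ((f y)%:E - ess_inf_on B f)].

Definition osc_class rho (beta theta : R) f :=
  loc_integrable f /\ osc_norm rho beta theta f < +oo.

Definition weight w := (forall x, (0 <= w x)%R) /\ loc_integrable w.

Definition weight_mean (q : R) w B : \bar R :=
  (avg B (fun y => (w y `^ q)%:E)) `^ q^-1.

(* The inverse of w is taken in \bar R, where 0^-1 = +oo, since the real
   power sends 0 to 0 for negative exponents. *)
Definition dual_mean (p : R) w B : \bar R :=
  if p == 1%R then (ess_inf_on B w)^-1
  else let p' := (p / (p - 1))%R in
       (avg B (fun y => ((w y)%:E)^-1 `^ p')) `^ p'^-1.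

Definition Apq_const rho (theta p q : R) w : \bar R :=
  ereal_sup [set u | exists x r, (0 < r)%R /\
    let B := eball x r in
    u = growth rho x r (- theta) * weight_mean q w B * dual_mean p w B].

(* Both factors are required to be finite, as 0 * +oo = 0 in \bar R. *)
Definition Apq_class rho (theta p q : R) w :=
  [/\ weight w,
      forall x r, (0 < r)%R ->
        weight_mean q w (eball x r) < +oo /\ dual_mean p w (eball x r) < +oo
    & Apq_const rho theta p q w < +oo].

Definition weighted_osc (beta q : R) w f B : \bar R :=
  (mu B `^ (beta / d%:R))^-1 *
  ((\int[mu]_(y in B) (w y `^ q)%:E)^-1 *
   \int[mu]_(y in B)
      (((f y)%:E - ess_inf_on B f) `^ q * (w y `^ q)%:E)) `^ q^-1.

End euclidean_space.

(* Main.v *)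
Require Import Defs.
From HB Require Import structures.
From mathcomp Require Import all_boot all_order all_algebra.
From mathcomp Require Import all_classical all_reals all_analysis.
From mathcomp Require Import ess_sup_inf measurable_realfun hoelder ring lra.
Set Implicit Arguments.
Unset Strict Implicit.
Unset Printing Implicit Defensive.
Import Order.TTheory GRing.Theory Num.Theory.
Import numFieldNormedType.Exports.
Local Open Scope classical_set_scope.
Local Open Scope ring_scope.

(* Part (2) is Hoelder's inequality with the weight [w]: the average over a
   ball of [f - essinf f] is at most the weighted q-average times
   [weight_mean * dual_mean], which is bounded by the constant of the weight.

   For part (1), write [m(x, r)] for the essential infimum of [f] on [B(x, r)].
   Since [B(x, r)] and [B(x, r/2)] have comparable volume, the norm of [f]
   bounds [m(x, r/2) - m(x, r)] by a multiple of [r^beta], and a geometric sum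
   bounds [m(z, s) - m(z, 2r)], uniformly in [s <= 2r], by a multiple of
   [r^beta]. Hence the integral of [f - m(x, r)] over the part in [B(x, r)] of
   a small dyadic cube is at most a constant [K] times the volume of the cube.
   An inequality between two finite measures on all dyadic cubes extends to all
   Borel sets, because these are approximated by unions of cubes; this replaces
   Lebesgue's differentiation theorem and gives [f - m(x, r) <= K] almost
   everywhere on [B(x, r)]. The exponent [(N0 + 1) theta1] comes from comparing
   the critical radius at the center of the ball with that at its points. *)

(* [all_analysis] exports another [edist]. *)
Local Notation edist := Defs.edist.

(** * Volume of Euclidean balls *)

Section balls.
Context (R : realType).

(** Open ball of the sup norm. Its measure is computed exactly, and Euclidean balls are only
    compared with it. *)
Definition cube n (x : n.-tuple R) (r : R) : set (n.-tuple R) :=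
  [set y | forall i, `|tnth x i - tnth y i| < r].

Lemma measurable_cube n (x : n.-tuple R) r : measurable (cube x r).
Proof.
rewrite (_ : cube x r = \bigcap_(i in [set: 'I_n])
    ((fun y : n.-tuple R => tnth y i) @^-1` ball (tnth x i) r)).
  apply: fin_bigcap_measurable; first exact: finite_finset.
  move=> i _; rewrite -[X in measurable X]setTI.
  by apply: measurable_tnth => //; exact: measurable_ball.
by apply/seteqP; split=> [y xy i _|y xy i]; [exact: xy|exact: xy].
Qed.

(** Induction on the dimension: along [pair_cons] the cube splits as an interval times a cube of one
    dimension less; in dimension 0 it is the whole one-point space, of mass 1. *)
Lemma lebesgue_cube n (x : n.-tuple R) r : 0 < r ->
  lebesgue_tuple R n (cube x r) = ((2 * r) ^+ n)%:E.
Proof.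
move=> r0; elim: n x => [|n IH] x.
  by rewrite /= diracE mem_set ?expr0// => -[].
rewrite /= /lebesgue_cons /pushforward.
pose x' := [tuple of behead x].
have -> : @pair_cons R n @^-1` cube x r = ball (thead x) r `*` cube x' r.
  apply/seteqP; split=> [[a u] /= h|[a u] /= [h1 h2] i].
    split; first by have := h ord0.
    by move=> i; have := h (lift ord0 i); rewrite {1}(tuple_eta x) !tnthS.
  by case: (unliftP ord0 i) => [j ->|->]//; rewrite {1}(tuple_eta x) !tnthS.
rewrite [LHS](product_measure1E _ (lebesgue_tuple R n))//; last 2 first.
- exact: measurable_ball.
- exact: measurable_cube.
transitivity ((r *+ 2)%:E * ((2 * r) ^+ n)%:E)%E.
  by congr (_ * _)%E; [exact: lebesgue_measure_ball (ltW r0)|exact: IH].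
by rewrite -EFinM exprS mulr_natl.
Qed.

End balls.

(** * Euclidean balls between inscribed and circumscribed cubes *)

Section eballs.
Context (R : realType) (d : nat).
Local Notation E := (d.-tuple R).
Local Notation mu := (lebesgue_tuple R d).
Implicit Types (x y z : E) (r : R).

Let sqs x y := \sum_(i < d) (tnth x i - tnth y i) ^+ 2.

Lemma edist_ltP x y r : 0 < r ->
  (edist x y < r) = (\sum_(i < d) (tnth x i - tnth y i) ^+ 2 < r ^+ 2).
Proof.
move=> r0; rewrite /edist -[in LHS](gtr0_norm r0) -sqrtr_sqr ltr_sqrt//.
exact: exprn_gt0.
Qed.

Lemma eball_center x r : 0 < r -> eball x r x.
Proof.
move=> r0; rewrite /eball/= edist_ltP// big1 ?exprn_gt0// => i _.
by rewrite subrr expr0n.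
Qed.

Lemma edistC x y : edist x y = edist y x.
Proof. by congr Num.sqrt; apply: eq_bigr => i _; rewrite -sqrrN opprB. Qed.

(** Summing (a + b)^2 <= 2 a^2 + 2 b^2 over the coordinates gives this special case of the triangle
    inequality without Cauchy-Schwarz. *)
Lemma eball_half_trans x y z r : 0 < r ->
  edist x y < r -> edist y z < r -> edist x z < 2 * r.
Proof.
move=> r0; rewrite !edist_ltP ?mulr_gt0// => xy yz.
have : sqs x z <= 2 * sqs x y + 2 * sqs y z.
  rewrite /sqs !mulr_sumr -big_split/=; apply: ler_sum => i _.
  have := sqr_ge0 ((tnth x i - tnth y i) - (tnth y i - tnth z i)); lra.
rewrite exprMn /sqs; lra.
Qed.

Lemma sub_eball x r s : r <= s -> eball x r `<=` eball x s.
Proof. by move=> rs y /= /lt_le_trans; exact. Qed.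

Lemma eball_sub_cube x r : 0 < r -> eball x r `<=` cube x r.
Proof.
move=> r0 y; rewrite /eball/= edist_ltP// => h i.
rewrite -(@ltr_pXn2r _ 2)// ?nnegrE ?ltW// real_normK ?num_real//.
apply: le_lt_trans h; rewrite (bigD1 i)//= lerDl.
by apply: sumr_ge0 => j _; exact: sqr_ge0.
Qed.

Lemma measurable_eball x r : measurable (eball x r).
Proof.
have mF : measurable_fun [set: E] (fun y => edist x y).
  apply: (measurableT_comp (continuous_measurable_fun (@sqrt_continuous R))).
  apply: measurable_sum => i.
  apply: measurable_funX; apply: measurable_funB => //.
  exact: measurable_tnth.
rewrite (_ : eball x r = (edist x) @^-1` `]-oo, r[).
  by rewrite -[X in measurable X]setTI; exact: mF.
by apply/seteqP; split=> y /=; rewrite in_itv.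
Qed.

Hypothesis d0 : (0 < d)%N.

(** A sum of [d] squares below (r/d)^2 is below r^2/d. The half-side [r / d%:R] is smaller than
    necessary but avoids a square root of the dimension. *)
Lemma cube_sub_eball x r : 0 < r -> cube x (r / d%:R) `<=` eball x r.
Proof.
move=> r0 y h; rewrite /eball/= edist_ltP//.
have d1 : 1 <= d%:R :> R by rewrite ler1n.
have : \sum_(i < d) (tnth x i - tnth y i) ^+ 2 < \sum_(i < d) (r / d%:R) ^+ 2.
  apply: ltr_sum; first by apply/hasP; exists (Ordinal d0); rewrite ?mem_index_enum.
  move=> i _; rewrite -real_normK ?num_real//.
  by rewrite ltr_pXn2r ?nnegrE ?divr_ge0 ?(ltW r0) ?ler0n//; exact: h.
move=> /lt_le_trans; apply; rewrite sumr_const card_ord -[_ *+ d]mulr_natl.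
have -> : d%:R * (r / d%:R) ^+ 2 = r ^+ 2 / d%:R :> R.
  by field; rewrite gt_eqF// (lt_le_trans ltr01).
by rewrite ler_pdivrMr ?(lt_le_trans ltr01)// ler_peMr// sqr_ge0.
Qed.

Lemma lebesgue_eball_le x r : 0 < r -> (mu (eball x r) <= ((2 * r) ^+ d)%:E)%E.
Proof.
move=> r0; rewrite -(lebesgue_cube x r0) le_measure ?inE//.
- exact: measurable_eball.
- exact: measurable_cube.
- exact: eball_sub_cube.
Qed.

Lemma lebesgue_eball_ge x r : 0 < r ->
  (((2 * (r / d%:R)) ^+ d)%:E <= mu (eball x r))%E.
Proof.
move=> r0; rewrite -(lebesgue_cube x); last by rewrite divr_gt0// ltr0n.
rewrite le_measure ?inE//.
- exact: measurable_cube.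
- exact: measurable_eball.
- exact: cube_sub_eball.
Qed.

Lemma lebesgue_eball_fin x r : 0 < r -> mu (eball x r) \is a fin_num.
Proof.
move=> r0; rewrite ge0_fin_numE//; apply: le_lt_trans (lebesgue_eball_le x r0) _.
exact: ltry.
Qed.

Definition vol x r : R := fine (mu (eball x r)).

Lemma lebesgue_eballE x r : 0 < r -> mu (eball x r) = (vol x r)%:E.
Proof. by move=> r0; rewrite fineK// lebesgue_eball_fin. Qed.

Lemma vol_le x r : 0 < r -> vol x r <= (2 * r) ^+ d.
Proof. by move=> r0; rewrite -lee_fin -lebesgue_eballE// lebesgue_eball_le. Qed.

Lemma vol_ge x r : 0 < r -> (2 * (r / d%:R)) ^+ d <= vol x r.
Proof. by move=> r0; rewrite -lee_fin -lebesgue_eballE// lebesgue_eball_ge. Qed.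

Lemma vol_gt0 x r : 0 < r -> 0 < vol x r.
Proof.
move=> r0; apply: lt_le_trans (vol_ge x r0).
by rewrite exprn_gt0// mulr_gt0// divr_gt0// ltr0n.
Qed.

End eballs.

(** * Approximation of Borel sets by unions of dyadic cubes *)

Section dyadic.
Context (R : realType) (d : nat) (a : R).
Hypothesis a_gt0 : 0 < a.
Local Notation E := (d.-tuple R).
Implicit Types (A : set E) (n : nat).

(** Names the half-open grid cube of side [a / 2 ^+ n] containing [x]. The scale [a] is left free so
    that it can be matched to the radius of a ball. *)
Definition dyadic_index n (x : E) : d.-tuple int :=
  [tuple Num.floor (tnth x i * 2 ^+ n / a) | i < d].

Definition dyadic_cell n (k : d.-tuple int) : set E :=
  [set x | dyadic_index n x = k].

(** Unions of grid cubes of generation [n], encoded as sets saturated for equality of indices;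
    complements and unions are then immediate. *)
Definition dyadic_set n A :=
  forall x y, dyadic_index n x = dyadic_index n y -> A x -> A y.

Lemma tnth_dyadic_index n x i :
  tnth (dyadic_index n x) i = Num.floor (tnth x i * 2 ^+ n / a).
Proof. by rewrite tnth_mktuple. Qed.

Lemma dyadic_index_pred n x y :
  dyadic_index n.+1 x = dyadic_index n.+1 y -> dyadic_index n x = dyadic_index n y.
Proof.
(* The floor of [u] is determined by the floor of [2 * u], so the grids are nested. *)
have floor_le2 (u v : R) : Num.floor (2 * u) = Num.floor (2 * v) ->
    Num.floor u <= Num.floor v.
  move=> uv; rewrite floor_ge_int.
  rewrite -(@ler_pM2l _ 2)//; apply: le_trans (floor_le (2 * v)).
  rewrite -uv -[X in X * _]/(2%:~R) -intrM ler_int floor_ge_int intrM.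
  by rewrite ler_pM2l// floor_le.
move=> xy; apply: eq_from_tnth => i; rewrite !tnth_dyadic_index.
have := congr1 (fun t => tnth t i) xy; rewrite !tnth_dyadic_index.
rewrite !(exprS, mulrCA _ 2) -!(mulrA 2) => h.
by apply/eqP; rewrite eq_le !floor_le2.
Qed.

Lemma dyadic_index_le n m x y : (n <= m)%N ->
  dyadic_index m x = dyadic_index m y -> dyadic_index n x = dyadic_index n y.
Proof.
move=> /subnKC <-; elim: (m - n)%N => [|k IH]; first by rewrite addn0.
by rewrite addnS => /dyadic_index_pred.
Qed.

Lemma dyadic_set_le n m A : (n <= m)%N -> dyadic_set n A -> dyadic_set m A.
Proof. by move=> nm hA x y /(dyadic_index_le nm); exact: hA. Qed.

Lemma dyadic_setU n A B : dyadic_set n A -> dyadic_set n B ->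
  dyadic_set n (A `|` B).
Proof. by move=> hA hB x y xy [/(hA _ _ xy)|/(hB _ _ xy)]; [left|right]. Qed.

Lemma dyadic_setC n A : dyadic_set n A -> dyadic_set n (~` A).
Proof. by move=> hA x y xy nAx Ay; apply: nAx; exact: hA Ay. Qed.

Lemma measurable_dyadic_cell n k : measurable (dyadic_cell n k).
Proof.
rewrite (_ : dyadic_cell n k = \bigcap_(i in [set: 'I_d])
    ((fun y : E => tnth y i) @^-1`
      `[(tnth k i)%:~R * a / 2 ^+ n, (tnth k i + 1)%:~R * a / 2 ^+ n[)).
  apply: fin_bigcap_measurable; first exact: finite_finset.
  move=> i _; rewrite -[X in measurable X]setTI.
  by apply: measurable_tnth => //; exact: measurable_itv.
have p2 : 0 < 2 ^+ n :> R by rewrite exprn_gt0.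
have idxP x i : reflect (Num.floor (tnth x i * 2 ^+ n / a) = tnth k i)
    ((tnth k i)%:~R * a / 2 ^+ n <= tnth x i < (tnth k i + 1)%:~R * a / 2 ^+ n).
  rewrite ler_pdivrMr// ltr_pdivlMr// -ler_pdivlMr// -ltr_pdivrMr//.
  by rewrite -floor_eq; exact: eqP.
apply/seteqP; split=> [x xk i _ /=|x h].
  by rewrite in_itv/=; apply/idxP; rewrite -xk tnth_dyadic_index.
apply: eq_from_tnth => i; rewrite tnth_dyadic_index; apply/idxP.
by have := h i I; rewrite /= in_itv.
Qed.

(** Two reals with the same floor differ by less than 1; rescaling gives the side of the cell. *)
Lemma dyadic_cell_sub_cube n z :
  dyadic_cell n (dyadic_index n z) `<=` cube z (a / 2 ^+ n).
Proof.
move=> x /= xz i; have p2 : 0 < 2 ^+ n :> R by rewrite exprn_gt0.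
have := congr1 (fun u => tnth u i) xz; rewrite !tnth_dyadic_index => h.
have /andP[x1 x2] := floor_itv (tnth x i * 2 ^+ n / a).
have /andP[z1 z2] := floor_itv (tnth z i * 2 ^+ n / a).
have : `|tnth z i * 2 ^+ n / a - tnth x i * 2 ^+ n / a| < 1.
  by move: x1 x2 z1 z2; rewrite h !intrD => *; rewrite ltr_norml; apply/andP; split; lra.
rewrite -!mulrBl -!mulrA normrM (ger0_norm (_ : 0 <= 2 ^+ n / a)).
  by rewrite mulrA ltr_pdivrMr// mul1r -ltr_pdivlMr.
by rewrite divr_ge0 ?ltW.
Qed.

(** The half-open cell contains the open cube with the same side and the same center, whose measure
    is known. *)
Lemma lebesgue_dyadic_cell_ge n k :
  (((a / 2 ^+ n) ^+ d)%:E <= lebesgue_tuple R d (dyadic_cell n k))%E.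
Proof.
have p2 : 0 < 2 ^+ n :> R by rewrite exprn_gt0.
pose l := a / 2 ^+ n; have l0 : 0 < l by rewrite divr_gt0.
pose c : E := [tuple ((tnth k i)%:~R + 2^-1) * l | i < d].
have l20 : 0 < l / 2 by rewrite divr_gt0.
rewrite (_ : a / 2 ^+ n = 2 * (l / 2)); last by rewrite [RHS]mulrC divfK ?pnatr_eq0.
rewrite -(lebesgue_cube c l20) le_measure ?inE//.
- exact: measurable_cube.
- exact: measurable_dyadic_cell.
move=> y cy; apply: eq_from_tnth => i; rewrite tnth_dyadic_index.
apply/eqP; rewrite floor_eq intrD.
have -> : tnth y i * 2 ^+ n / a = tnth y i / l.
  by rewrite /l invf_div mulrA.
have := cy i; rewrite tnth_mktuple ltr_norml ler_pdivlMr// ltr_pdivrMr//.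
by move=> /andP[h1 h2]; apply/andP; split; lra.
Qed.

(** Sequence of the cells of generation [n] that meet [A], enumerated through the countable type of
    indices. Positions that code no such cell get the empty set, and [pickle_inv] lists no index
    twice, so the sequence is disjoint. *)
Let cells n A (i : nat) : set E :=
  if pickle_inv i is Some k then
    if `[< exists2 x, A x & dyadic_index n x = k >] then dyadic_cell n k else set0
  else set0.

Let cells_trivIset n A : trivIset setT (cells n A).
Proof.
apply/trivIsetP => i j _ _ ij; rewrite /cells.
case ei : (pickle_inv i) => [k|]; last by rewrite set0I.
case ej : (pickle_inv j) => [l|]; last by rewrite setI0.
case: ifP => _; last by rewrite set0I.
case: ifP => _; last by rewrite setI0.
rewrite -subset0 => x [/= xk xl]; move: ij; apply/negP; rewrite negbK.
have := @pickle_invK (d.-tuple int) i; have := @pickle_invK (d.-tuple int) j.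
by rewrite ei ej /= -xk -xl => <- <-.
Qed.

Let measurable_cells n A i : measurable (cells n A i).
Proof.
rewrite /cells; case: pickle_inv => // k; case: ifP => // _.
exact: measurable_dyadic_cell.
Qed.

Let bigcup_cells n A : dyadic_set n A -> A = \bigcup_i cells n A i.
Proof.
move=> hA; apply/seteqP; split=> [x Ax|x [i _]].
  exists (pickle (dyadic_index n x)) => //.
  by rewrite /cells pickleK_inv ifT//; apply/asboolP; exists x.
rewrite /cells; case: pickle_inv => // k; case: ifPn => // /asboolP[y Ay <-].
by move=> /esym yx; exact: hA yx Ay.
Qed.

Lemma measurable_dyadic_set n A : dyadic_set n A -> measurable A.
Proof.
by move=> /bigcup_cells ->; apply: bigcup_measurable => i _; exact: measurable_cells.
Qed.

Local Open Scope ereal_scope.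

Lemma le_measure_dyadic_set n (m1 m2 : {measure set E -> \bar R}) :
  (forall k, m1 (dyadic_cell n k) <= m2 (dyadic_cell n k)) ->
  forall A, dyadic_set n A -> m1 A <= m2 A.
Proof.
move=> h A /bigcup_cells ->; rewrite !measure_bigcup//.
apply: lee_nneseries => // i _; rewrite /cells; case: pickle_inv => [k|].
  by case: ifP => _; rewrite ?measure0.
by rewrite !measure0.
Qed.

(** * Approximation of Borel sets by dyadic sets for a finite measure *)

Section approximation.
Variable m : {measure set E -> \bar R}.
Hypothesis m_fin : m setT < +oo.

Definition dyadic_approx A := measurable A /\ forall e : R, (0 < e)%R ->
  exists n B, [/\ dyadic_set n B, m (A `\` B) < e%:E & m (B `\` A) < e%:E].

Let m_lty A : measurable A -> m A < +oo.
Proof. by move=> mA; apply: le_lt_trans m_fin; rewrite le_measure ?inE. Qed.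

Lemma dyadic_set_approx n A : dyadic_set n A -> dyadic_approx A.
Proof.
move=> hA; split; first exact: measurable_dyadic_set hA.
by move=> e e0; exists n, A; rewrite setDv measure0 lte_fin.
Qed.

Lemma dyadic_approxC A : dyadic_approx A -> dyadic_approx (~` A).
Proof.
move=> [mA hA]; split; first exact: measurableC.
move=> e /hA[n [B [hB AB BA]]]; exists n, (~` B).
by split; [exact: dyadic_setC|..]; rewrite !setDE !setCK setIC -setDE.
Qed.

(** Nestedness of the grids brings both approximating sets to the common generation [maxn n1 n2],
    and the errors add up. *)
Lemma dyadic_approxU A1 A2 : dyadic_approx A1 -> dyadic_approx A2 ->
  dyadic_approx (A1 `|` A2).
Proof.
move=> [mA1 hA1] [mA2 hA2]; split; first exact: measurableU.
move=> e e0; have e20 : (0 < e / 2)%R by rewrite divr_gt0.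
have [n1 [B1 [hB1 AB1 BA1]]] := hA1 _ e20.
have [n2 [B2 [hB2 AB2 BA2]]] := hA2 _ e20.
have mB1 := measurable_dyadic_set hB1; have mB2 := measurable_dyadic_set hB2.
exists (maxn n1 n2), (B1 `|` B2).
have bound (X1 X2 Y1 Y2 : set E) : measurable X1 -> measurable X2 ->
    measurable Y1 -> measurable Y2 -> m (X1 `\` Y1) < (e / 2)%:E ->
    m (X2 `\` Y2) < (e / 2)%:E -> m ((X1 `|` X2) `\` (Y1 `|` Y2)) < e%:E.
  move=> mX1 mX2 mY1 mY2 h1 h2.
  apply: (@le_lt_trans _ _ (m ((X1 `\` Y1) `|` (X2 `\` Y2)))).
    rewrite le_measure ?inE//.
    - by apply: measurableD; exact: measurableU.
    - by apply: measurableU; exact: measurableD.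
    - by move=> x [[X1x|X2x] /not_orP[Y1x Y2x]]; [left|right].
  apply: le_lt_trans (measureU2 _ _ _) _; try exact: measurableD.
  by rewrite (splitr e) EFinD lteD.
split; [|exact: bound|exact: bound].
by apply: dyadic_setU; [apply: dyadic_set_le hB1|apply: dyadic_set_le hB2];
  rewrite ?leq_maxl ?leq_maxr.
Qed.

(** A dyadic set has one fixed generation, so the countable union is first cut to a finite one with
    a tail of small measure. *)
Lemma dyadic_approx_bigcup (F : (set E)^nat) :
  (forall i, dyadic_approx (F i)) -> dyadic_approx (\bigcup_i F i).
Proof.
move=> hF; have mF i : measurable (F i) by have [] := hF i.
have mU : measurable (\bigcup_i F i) by exact: bigcup_measurable.
split=> // e e0; have e20 : (0 < e / 2)%R by rewrite divr_gt0.
pose G n := \big[setU/set0]_(i < n) F i.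
have hG n : dyadic_approx (G n).
  elim: n => [|n IH]; rewrite /G; last by rewrite big_ord_recr; exact: dyadic_approxU.
  by rewrite big_ord0; exact: (@dyadic_set_approx 0).
have mG n : measurable (G n) by have [] := hG n.
pose T n := (\bigcup_i F i) `\` G n.
have mT n : measurable (T n) by exact: measurableD.
have GF n : G n `<=` \bigcup_i F i by exact: bigsetU_bigcup.
have T0 : \bigcap_n T n = set0.
  rewrite -subset0 => x hx; have [[i _ Fx] _] := hx 0%N I.
  have [_] := hx i.+1 I; apply; rewrite /G big_ord_recr; right; exact: Fx.
(* Continuity from above, which is where finiteness of [m] enters: the tails [T n] decrease to the
   empty set. *)
have : m \o T @ \oo --> m (\bigcap_n T n).
  apply: nonincreasing_cvg_mu => //; first exact: m_lty.
    by rewrite T0.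
  move=> n k nk; apply/subsetPset; apply: setDS.
  exact: subset_bigsetU.
rewrite T0 measure0 => /fine_cvgP[_ /cvgrPdist_lt /(_ _ e20)][N _ /(_ N (leqnn N))].
rewrite /= sub0r normrN ger0_norm ?fine_ge0// => TN.
have {}TN : m (T N) < (e / 2)%:E by rewrite -[m _]fineK ?lte_fin// ge0_fin_numE ?m_lty.
have [n [B [hB AB BA]]] := (hG N).2 _ e20.
have mB := measurable_dyadic_set hB.
exists n, B; split=> //.
  apply: (@le_lt_trans _ _ (m (T N `|` (G N `\` B)))).
    rewrite le_measure ?inE//; first exact: measurableD.
      by apply: measurableU => //; exact: measurableD.
    move=> x [Ux Bx]; have [Gx|Gx] := pselect (G N x); [by right|by left].
  apply: le_lt_trans (measureU2 _ _ _) _ => //; first exact: measurableD.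
  by rewrite (splitr e) EFinD lteD.
apply: (@le_lt_trans _ _ (m (B `\` G N))).
  by rewrite le_measure ?inE//; [exact: measurableD..|exact: setDS].
by apply: lt_le_trans BA _; rewrite lee_fin ler_pdivrMr// ler_pMr// ler1n.
Qed.

(** The approximable sets form a sigma-algebra, so it suffices to treat generators: coordinate
    preimages of the rays []t, +oo[]. *)
Lemma measurable_dyadic_approx A : measurable A -> dyadic_approx A.
Proof.
have sig : sigma_algebra setT dyadic_approx.
  split; first exact: (@dyadic_set_approx 0).
  - by move=> B hB; rewrite setTD; exact: dyadic_approxC.
  - exact: dyadic_approx_bigcup.
suff : measurable `<=` dyadic_approx by exact.
apply: smallest_sub => //; rewrite -bigcup_seq => B [i _] [C mC <-].
rewrite setTI.
suff : <<s @RGenOInfty.G R >> `<=`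
    [set D | dyadic_approx ((fun x : E => tnth x i) @^-1` D)].
  by apply; have := mC; rewrite /measurable/= [X in X C](RGenOInfty.measurableE R).
apply: smallest_sub.
  split; first by rewrite /= preimage_set0; exact: (@dyadic_set_approx 0).
  - by move=> D hD; rewrite /= setTD preimage_setC; exact: dyadic_approxC.
  - by move=> F hF; rewrite /= preimage_bigcup; exact: dyadic_approx_bigcup.
move=> _ [t ->] /=.
(* Union of the cells of generation [n] whose lower face in direction [i] lies strictly beyond [t].
   These sets exhaust the open half-space: a point of it belongs to [H n] once the mesh [a / 2 ^+ n]
   is smaller than [tnth x i - t]. *)
pose H n := [set x : E | (t * 2 ^+ n / a < (Num.floor (tnth x i * 2 ^+ n / a))%:~R)%R].
have -> : (fun x : E => tnth x i) @^-1` `]t, +oo[ = \bigcup_n H n.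
  apply/seteqP; split=> [x|x [n _]] /=; rewrite in_itv/= andbT.
    move=> tx; have [n] : exists n, (a / (tnth x i - t) < 2 ^+ n)%R.
      exists (Num.truncn (a / (tnth x i - t))).+1.
      apply: lt_trans (truncnS_gt _) _.
      by rewrite -natrX ltr_nat ltn_expl.
    rewrite ltr_pdivrMr ?subr_gt0// -{1}[a]mul1r -ltr_pdivlMr// mulrBr mulrBl => h.
    exists n => //; rewrite /H/=.
    have /andP[_] := floor_itv (tnth x i * 2 ^+ n / a)%R; rewrite intrD => h1.
    by move: h h1; rewrite ![(2 ^+ n * _)%R]mulrC; lra.
  rewrite /H/= => /lt_le_trans /(_ (floor_le _)).
  by rewrite !ltr_pM2r ?invr_gt0// exprn_gt0.
apply: dyadic_approx_bigcup => n; apply: (@dyadic_set_approx n) => x y xy.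
by rewrite /H/= -!tnth_dyadic_index xy.
Qed.

End approximation.

(** The inequality passes from cells to dyadic sets by countable additivity, and then to [A] by
    replacing [A] with a dyadic set at a cost of e/2 for each measure. *)
Lemma le_measure_dyadic (m1 m2 : {measure set E -> \bar R}) :
  m1 setT < +oo -> m2 setT < +oo ->
  (forall n k, m1 (dyadic_cell n k) <= m2 (dyadic_cell n k)) ->
  forall A, measurable A -> m1 A <= m2 A.
Proof.
move=> m1fin m2fin h A mA; apply/lee_addgt0Pr => e e0.
have e20 : (0 < e / 2)%R by rewrite divr_gt0.
(* Approximation with respect to the sum yields one dyadic set that is good for both measures. *)
have mfin : measure_add m1 m2 setT < +oo by rewrite measure_addE lte_add_pinfty.
have [_ /(_ _ e20)[n [B [hB]]]] := measurable_dyadic_approx mfin mA.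
move=> AB BA.
have mB := measurable_dyadic_set hB.
have le_U (m : {measure set E -> \bar R}) X Y : measurable X -> measurable Y ->
    m X <= m Y + m (X `\` Y).
  move=> mX mY; apply: le_trans (measureU2 _ _ _) => //; last exact: measurableD.
  rewrite le_measure ?inE//; first by apply: measurableU => //; exact: measurableD.
  by move=> x Xx; have [Yx|Yx] := pselect (Y x); [left|right].
have AB1 : m1 (A `\` B) <= (e / 2)%:E.
  by apply: le_trans (ltW AB); rewrite [leRHS]measure_addE leeDl.
have BA2 : m2 (B `\` A) <= (e / 2)%:E.
  by apply: le_trans (ltW BA); rewrite [leRHS]measure_addE leeDr.
apply: le_trans (le_U m1 A B mA mB) _.
rewrite (splitr e) EFinD addeA leeD//.
apply: le_trans (le_measure_dyadic_set (h n) hB) _.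
by apply: le_trans (le_U m2 B A mB mA) _; rewrite leeD2l.
Qed.

End dyadic.

(** * Essential infima on a set *)

Section density.
Context (disp : measure_display) (T : measurableType disp) (R : realType).
Variables (mu : {measure set T -> \bar R}) (g : T -> \bar R).
Hypotheses (g_ge0 : forall x, (0 <= g x)%E) (mg : measurable_fun setT g).

(** The two proofs are arguments so that the measure structure can be attached to the term
    itself. *)
Definition density_measure & (forall x, (0 <= g x)%E) & measurable_fun setT g :=
  fun A : set T => (\int[mu]_(x in A) g x)%E.

Local Notation nu := (density_measure g_ge0 mg).

Let nu0 : nu set0 = 0%E.
Proof. exact: integral_set0. Qed.

Let nu_ge0 A : (0 <= nu A)%E.
Proof. exact: integral_ge0. Qed.

Let nu_sigma_additive : semi_sigma_additive nu.
Proof.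
move=> F mF tF mUF; rewrite /density_measure ge0_integral_bigcup//.
  by apply: is_cvg_ereal_nneg_natsum_cond => n _ _; exact: integral_ge0.
exact: measurable_funTS.
Qed.

HB.instance Definition _ := isMeasure.Build _ _ _
  nu nu0 nu_ge0 nu_sigma_additive.

End density.

(** * Essential infimum on a set and the excess of a function over it *)

Section ess_inf_on_theory.
Context (R : realType) (d : nat).
Local Notation E := (d.-tuple R).
Local Notation mu := (lebesgue_tuple R d).
Implicit Types (A B : set E) (f : E -> R).
Local Open Scope ereal_scope.

Lemma ess_inf_onP B f y :
  y <= ess_inf_on B f <-> (\forall x \ae mu, B x -> y <= (f x)%:E).
Proof.
apply: (@iff_trans _ (\forall x \ae mu, y <= patch (cst +oo) B (EFin \o f) x)).
  by split=> /ess_infP.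
split; apply: filterS => x; rewrite /patch; last first.
  by case: ifPn => [/set_mem Bx /(_ Bx)//|_ _]; rewrite leey.
by move=> + Bx; rewrite mem_set.
Qed.

Lemma ess_inf_on_le B f : \forall x \ae mu, B x -> ess_inf_on B f <= (f x)%:E.
Proof. exact/ess_inf_onP. Qed.

Lemma le_ess_inf_on A B f : A `<=` B -> ess_inf_on B f <= ess_inf_on A f.
Proof.
move=> AB; apply/ess_inf_onP; apply: filterS (ess_inf_on_le B f) => x h Ax.
by apply: h; exact: AB.
Qed.

Lemma ae_false B : measurable B -> (\forall x \ae mu, ~ B x) -> mu B = 0.
Proof.
move=> mB h; apply: measure_negligible => //; apply: negligibleS h => x Bx; exact.
Qed.

Lemma ess_inf_on_lty B f : measurable B -> 0 < mu B -> ess_inf_on B f < +oo.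
Proof.
move=> mB B0; rewrite ltey; apply/eqP => h; move: B0.
rewrite ae_false ?ltxx//.
by apply: filterS (ess_inf_on_le B f) => x + Bx => /(_ Bx); rewrite h leye_eq.
Qed.

(* The real value of the essential infimum; the junk value 0 at infinity is
   excluded wherever it is used. *)
Definition essi B f : R := fine (ess_inf_on B f).

(** Real-valued form of [f] minus its essential infimum. The truncation at 0 makes it nonnegative
    everywhere and changes it only on a null subset of [B] when the infimum is finite. *)
Definition excess B f x : R := Num.max (f x - essi B f)%R 0%R.

Lemma excess_ge0 B f x : (0 <= excess B f x)%R.
Proof. by rewrite /excess le_max lexx orbT. Qed.

Lemma measurable_excess B f A : measurable A -> measurable_fun A f ->
  measurable_fun A (excess B f).
Proof.
move=> mA mf; apply: measurable_maxr => //.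
by apply: measurable_funB.
Qed.

Lemma ae_excess B f : ess_inf_on B f \is a fin_num ->
  \forall x \ae mu, B x -> (f x)%:E - ess_inf_on B f = (excess B f x)%:E.
Proof.
move=> fin; apply: filterS (ess_inf_on_le B f) => x h Bx.
rewrite -(fineK fin) -EFinB /excess max_l//.
by rewrite subr_ge0 -lee_fin fineK//; exact: h.
Qed.

Lemma integral_excess B f : measurable B -> measurable_fun B f ->
  ess_inf_on B f \is a fin_num ->
  \int[mu]_(x in B) ((f x)%:E - ess_inf_on B f) =
  \int[mu]_(x in B) (excess B f x)%:E.
Proof.
move=> mB mf fin; apply: ae_eq_integral => //.
- rewrite -(fineK fin); apply/measurable_EFinP.
  by apply: measurable_funB.
- by apply/measurable_EFinP; exact: measurable_excess.
- exact: ae_excess.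
Qed.

(** The value [-oo] would make the integrand [+oo] on a set of positive measure; [+oo] is impossible
    because [f] is real-valued. *)
Lemma integral_lty_ess_inf_on B f : measurable B -> 0 < mu B ->
  \int[mu]_(x in B) ((f x)%:E - ess_inf_on B f) < +oo ->
  ess_inf_on B f \is a fin_num.
Proof.
move=> mB B0 h; rewrite fin_numE -ltey ess_inf_on_lty// andbT.
apply: contraTN h => /eqP ->; rewrite -leNgt.
under eq_integral do rewrite /= addey//.
by rewrite integral_cst// gt0_mulye.
Qed.

End ess_inf_on_theory.

(** * Growth factors *)


Section growth_theory.
Context (R : realType) (d : nat).
Local Notation E := (d.-tuple R).
Variable rho : E -> R.
Hypothesis rho_gt0 : forall x, 0 < rho x.
Implicit Types (x y : E) (r s t : R).

Definition gr x r t : R := (1 + r / rho x) `^ t.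

Lemma growthE x r t : growth rho x r t = (gr x r t)%:E.
Proof. by []. Qed.

Lemma gr_base_ge1 x r : 0 <= r -> 1 <= 1 + r / rho x.
Proof. by move=> r0; rewrite lerDl divr_ge0// ltW. Qed.

Lemma gr_gt0 x r t : 0 <= r -> 0 < gr x r t.
Proof. by move=> r0; rewrite powR_gt0// (lt_le_trans ltr01)// gr_base_ge1. Qed.

Lemma grN x r t : gr x r (- t) = (gr x r t)^-1.
Proof. exact: powRN. Qed.

Lemma grD x r s t : 0 <= r -> gr x r (s + t) = gr x r s * gr x r t.
Proof.
move=> r0; rewrite /gr powRD//; apply/implyP => _.
by rewrite gt_eqF// (lt_le_trans ltr01)// gr_base_ge1.
Qed.

Lemma le_gr x r s t : 0 <= t -> 0 <= r -> r <= s -> gr x r t <= gr x s t.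
Proof.
move=> t0 r0 rs; apply: ge0_ler_powR => //; rewrite ?nnegrE ?(le_trans ler01)//.
- exact: gr_base_ge1.
- by apply: gr_base_ge1; exact: le_trans rs.
- by rewrite lerD2l ler_pM2r// invr_gt0.
Qed.

(** Source of the exponent [(N0 + 1) * theta1]: the lower bound on [rho z / rho x] costs a power
    [N0] of [1 + r / rho x], and [r / rho x] itself accounts for one more. *)
Lemma gr_shift (C0 N0 : R) x z r t : 0 < C0 -> 0 < N0 -> 0 < r -> 0 <= t ->
  admissible_constants rho C0 N0 -> edist x z < r ->
  gr z (2 * r) t <= (1 + 2 * C0) `^ t * gr x r ((N0 + 1) * t).
Proof.
move=> C00 N00 r0 t0 adm xz.
have b1 : 1 <= 1 + r / rho x by apply: gr_base_ge1; exact: ltW.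
have b0 : 0 < 1 + r / rho x by exact: lt_le_trans b1.
rewrite /gr powRrM -powRM ?powR_ge0//; last first.
  by rewrite addr_ge0// mulr_ge0// ltW.
apply: ge0_ler_powR => //; rewrite ?nnegrE ?mulr_ge0 ?powR_ge0//.
- by rewrite (le_trans ler01)// gr_base_ge1// mulr_ge0// ltW.
- by rewrite addr_ge0// mulr_ge0// ltW.
have [h _] := adm x z.
set P := (1 + r / rho x) `^ (N0 + 1).
have P1 : 1 <= P.
  by rewrite /P -[leLHS](powRr0 (1 + r / rho x)) ler_powR// addr_ge0// ltW.
rewrite [leRHS]mulrDl mul1r lerD// -!mulrA ler_pM2l//.
have e0 : 0 <= edist x z / rho x by apply: divr_ge0; [exact: sqrtr_ge0|exact: ltW].
have h1 : (1 + r / rho x) `^ (- N0) <= (1 + edist x z / rho x) `^ (- N0).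
  have e1 : 0 < 1 + edist x z / rho x by rewrite ltr_wpDr.
  (* The exponent is negative, so enlarging the distance from [edist x z] to [r] decreases the
     power. *)
  rewrite !powRN lef_pV2 ?posrE ?powR_gt0//.
  apply: ge0_ler_powR; rewrite ?nnegrE// ?(ltW N00) ?(ltW b0) ?(ltW e1)//.
  by rewrite lerD2l ler_pM2r ?invr_gt0// ltW.
have h2 : C0^-1 * (1 + r / rho x) `^ (- N0) <= rho z / rho x.
  by apply: le_trans h; rewrite ler_pM2l ?h1 ?invr_gt0.
have : r / rho z <= C0 * (1 + r / rho x) `^ N0 * (r / rho x).
  have p0 : 0 < C0^-1 * (1 + r / rho x) `^ (- N0).
    by rewrite mulr_gt0 ?invr_gt0 ?powR_gt0.
  have := ler_wpM2l (ltW (divr_gt0 r0 (rho_gt0 z))) h2.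
  have -> : r / rho z * (rho z / rho x) = r / rho x by field; rewrite !gt_eqF.
  move=> h3.
  rewrite -(ler_pM2r p0); apply: le_trans h3 _.
  rewrite powRN; set Q := _ `^ N0; have Q0 : 0 < Q by rewrite powR_gt0.
  by rewrite (_ : C0 * Q * _ * _ = r / rho x)//; field; rewrite !gt_eqF.
move=> /le_trans; apply; rewrite -mulrA ler_pM2l// /P.
rewrite powRD; last by apply/implyP => _; rewrite gt_eqF.
by rewrite powRr1 ?(ltW b0)// ler_pM2l ?powR_gt0// lerDr.
Qed.

End growth_theory.

(** * Functions of bounded oscillation *)


Lemma powR_half_lt1 (R : realType) (b : R) : 0 < b -> 2 `^ (- b) < 1 :> R.
Proof.
move=> b0; rewrite powRN invf_lt1 ?powR_gt0//.
have : 1 `^ b < 2 `^ b by rewrite gt0_ltr_powR ?nnegrE ?ltr1n.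
by rewrite powR1.
Qed.

Section oscillation.
Context (R : realType) (d : nat).
Hypothesis d_gt0 : (0 < d)%N.
Local Notation E := (d.-tuple R).
Local Notation mu := (lebesgue_tuple R d).
Variables (rho : E -> R) (beta theta : R) (f : E -> R).
Hypotheses (rho_gt0 : forall x, 0 < rho x) (beta_gt0 : 0 < beta)
  (theta_ge0 : 0 <= theta) (f_osc : osc_class rho beta theta f).
Implicit Types (x y z : E) (r s : R).

Let mB := @measurable_eball R d.

Lemma measurable_fun_loc x r (g : E -> R) : 0 < r -> loc_integrable g ->
  measurable_fun (eball x r) g.
Proof.
by move=> r0 /(_ x r r0) /(measurable_int mu) /measurable_EFinP.
Qed.

Let mf : forall x r, 0 < r -> measurable_fun (eball x r) f.
Proof. by move=> x r r0; apply: measurable_fun_loc => //; have [] := f_osc. Qed.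

Lemma lebesgue_eball_gt0 x r : 0 < r -> (0 < mu (eball x r))%E.
Proof. by move=> r0; rewrite lebesgue_eballE// lte_fin vol_gt0. Qed.

Lemma growth_volE x r s : 0 < r ->
  (growth rho x r (- theta) * (mu (eball x r) `^ s)^-1)%E =
  ((gr rho x r theta * vol x r `^ s)^-1)%:E.
Proof.
move=> r0; rewrite growthE grN lebesgue_eballE// poweR_EFin inver.
by rewrite gt_eqF ?powR_gt0 ?vol_gt0// -EFinM invfM.
Qed.

Let le_osc_norm x r : 0 < r ->
  (((gr rho x r theta * vol x r `^ (1 + beta / d%:R))^-1)%:E *
   \int[mu]_(y in eball x r) ((f y)%:E - ess_inf_on (eball x r) f) <=
   osc_norm rho beta theta f)%E.
Proof.
move=> r0; rewrite -growth_volE//; apply: ereal_sup_ubound.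
by exists x, r.
Qed.

Let c_gt0 x r s : 0 < r -> 0 < gr rho x r theta * vol x r `^ s.
Proof.
by move=> r0; rewrite mulr_gt0 ?gr_gt0 ?(ltW r0)// powR_gt0// vol_gt0.
Qed.

Lemma osc_ess_inf_fin x r : 0 < r -> ess_inf_on (eball x r) f \is a fin_num.
Proof.
move=> r0; apply: integral_lty_ess_inf_on; [exact: mB|exact: lebesgue_eball_gt0|].
have [_] := f_osc; apply: contraTT; rewrite -!leNgt !leye_eq => /eqP h.
have := le_osc_norm x r0; rewrite h gt0_muley ?leye_eq//.
by rewrite lte_fin invr_gt0 c_gt0.
Qed.

Lemma osc_norm_ge0 : (0 <= osc_norm rho beta theta f)%E.
Proof.
pose x : E := [tuple 0 | i < d].
apply: le_trans (le_osc_norm x ltr01); apply: mule_ge0.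
  by rewrite lee_fin invr_ge0 ltW// c_gt0.
rewrite integral_excess ?osc_ess_inf_fin//; last exact: (@mf _ _ ltr01).
by apply: integral_ge0 => y _; rewrite lee_fin excess_ge0.
Qed.

Let N := fine (osc_norm rho beta theta f).

Let N_ge0 : 0 <= N. Proof. exact/fine_ge0/osc_norm_ge0. Qed.

Let NE : osc_norm rho beta theta f = N%:E.
Proof. by rewrite fineK// ge0_fin_numE ?osc_norm_ge0//; case: f_osc. Qed.

(** Bound for the average of the excess over [eball x r]: the norm, the growth factor, and the power
    [beta / d%:R] of the volume, estimated through the circumscribed cube. *)
Let A x r := N * gr rho x r theta * (2 * r) `^ beta.

Let A_ge0 x r : 0 < r -> 0 <= A x r.
Proof. by move=> r0; rewrite !mulr_ge0// ?powR_ge0. Qed.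

Let le_A x r s : 0 < r -> r <= s -> A x r <= A x s.
Proof.
move=> r0 rs; have s0 := lt_le_trans r0 rs.
apply: ler_pM; rewrite ?mulr_ge0 ?powR_ge0//.
  by rewrite ler_wpM2l// le_gr// ltW.
by apply: ge0_ler_powR; rewrite ?nnegrE ?mulr_ge0 ?ler_pM2l// ltW.
Qed.

Lemma integral_excess_le x r : 0 < r ->
  (\int[mu]_(y in eball x r) (excess (eball x r) f y)%:E <=
   (A x r * vol x r)%:E)%E.
Proof.
move=> r0; rewrite -integral_excess ?osc_ess_inf_fin//; last exact: mf.
have := le_osc_norm x r0; rewrite NE lee_pdivrMl ?c_gt0// => /le_trans; apply.
have v0 := vol_gt0 d_gt0 x r0.
rewrite -EFinM lee_fin /A powRD; last by apply/implyP => _; rewrite gt_eqF.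
rewrite powRr1 ?(ltW v0)//.
rewrite (_ : _ * N = N * gr rho x r theta * vol x r * vol x r `^ (beta / d%:R)); last by ring.
rewrite [leRHS]mulrAC ler_wpM2l//.
  by rewrite !mulr_ge0 ?powR_ge0 ?(ltW v0).
apply: (@le_trans _ _ (((2 * r) `^ d%:R) `^ (beta / d%:R))).
  apply: ge0_ler_powR; rewrite ?nnegrE ?powR_ge0 ?divr_ge0 ?(ltW v0) ?(ltW beta_gt0)//.
  by rewrite powR_mulrn ?mulr_ge0 ?(ltW r0)// vol_le.
rewrite -powRrM (_ : d%:R * _ = beta)//; field.
by rewrite pnatr_eq0 -lt0n.
Qed.

(** Doubling constant: the volume ratio of the cube around a ball of radius [r] to the cube used
    inside the ball of radius [r / 2]. *)
Let D : R := (2 * d%:R) ^+ d.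

Let D_ge1 : 1 <= D.
Proof. by rewrite exprn_ege1// -natrM ler1n muln_gt0. Qed.

Let vol_doubling x r : 0 < r -> vol x r <= D * vol x (r / 2).
Proof.
move=> r0; apply: le_trans (vol_le x r0) _.
have r20 : 0 < r / 2 by rewrite divr_gt0.
apply: le_trans (ler_wpM2l (le_trans ler01 D_ge1) (vol_ge d_gt0 x r20)).
rewrite /D -exprMn (_ : 2 * d%:R * _ = 2 * r)//; field.
by rewrite pnatr_eq0 -lt0n.
Qed.

Let m x r := essi (eball x r) f.

Let le_m (S T : set E) : S `<=` T -> ess_inf_on S f \is a fin_num ->
  ess_inf_on T f \is a fin_num -> essi T f <= essi S f.
Proof. by move=> ST fS fT; rewrite fine_le// le_ess_inf_on. Qed.

(** Almost everywhere on the half ball the excess over the large ball is at least the difference of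
    the two infima; integrate over the half ball and use doubling. *)
Lemma essi_half x r : 0 < r -> m x (r / 2) - m x r <= D * A x r.
Proof.
move=> r0; have r20 : 0 < r / 2 by rewrite divr_gt0.
have sub : eball x (r / 2) `<=` eball x r by apply: sub_eball; lra.
have v0 := vol_gt0 d_gt0 x r20.
rewrite -(ler_pM2r v0); apply: (@le_trans _ _ (A x r * vol x r)); last first.
  have := ler_wpM2l (A_ge0 x r0) (vol_doubling x r0).
  by rewrite mulrA [A x r * D]mulrC.
rewrite -lee_fin; apply: le_trans (integral_excess_le x r0).
have mex := measurable_excess (eball x r) (mB x r) (@mf x r r0).
apply: (@le_trans _ _ (\int[mu]_(y in eball x (r / 2)) (excess (eball x r) f y)%:E)%E);
  last first.
  apply: ge0_subset_integral => //; first exact/measurable_EFinP.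
  by move=> y _; rewrite lee_fin excess_ge0.
rewrite EFinM -lebesgue_eballE// -integral_cst//.
apply: ae_ge0_le_integral; first exact: mB.
- by move=> y _; rewrite /= lee_fin subr_ge0 le_m ?osc_ess_inf_fin.
- exact: measurable_cst.
- by move=> y _; rewrite lee_fin excess_ge0.
- by apply/measurable_EFinP; apply: measurable_funS mex.
apply: filterS (ess_inf_on_le (eball x (r / 2)) f) => y /[apply] h.
rewrite /= lee_fin le_max lerD2r -lee_fin fineK ?osc_ess_inf_fin//.
by rewrite h.
Qed.

(** Factor gained in [A] at each halving of the radius, hence the ratio of the geometric sum. *)
Let t : R := 2 `^ (- beta).

Let t_gt0 : 0 < t. Proof. by rewrite powR_gt0. Qed.

Let t_lt1 : t < 1. Proof. exact: powR_half_lt1. Qed.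

Lemma essi_chain x r n : 0 < r ->
  m x (r / 2 ^+ n) - m x r <= D * A x r / (1 - t).
Proof.
move=> r0; have DA0 : 0 <= D * A x r by rewrite mulr_ge0 ?A_ge0// (le_trans ler01).
rewrite ler_pdivlMr ?subr_gt0//.
(* The closed form of the partial geometric sum, cleared of its denominator, is the invariant of the
   induction. *)
suff : (m x (r / 2 ^+ n) - m x r) * (1 - t) <= D * A x r * (1 - t ^+ n).
  by move=> /le_trans; apply; rewrite ler_piMr// gerBl exprn_ge0// ltW.
elim: n => [|n IH]; first by rewrite !expr0 invr1 mulr1 !subrr mul0r mulr0.
set s := r / 2 ^+ n; have s0 : 0 < s by rewrite divr_gt0// exprn_gt0.
have -> : r / 2 ^+ n.+1 = s / 2 by rewrite exprS invfM mulrCA mulrC.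
(* The power of the radius shrinks by exactly [t ^+ n], while the growth factor does not
   increase. *)
have As : A x s <= A x r * t ^+ n.
  have sr : s <= r by rewrite ler_pdivrMr ?exprn_gt0// ler_peMr ?(ltW r0)// exprn_ege1// ler1n.
  rewrite /A -[leRHS]mulrA; apply: ler_pM; rewrite ?mulr_ge0 ?powR_ge0//.
    by rewrite ler_wpM2l// le_gr// ltW.
  rewrite /s mulrA powRM ?mulr_ge0 ?invr_ge0 ?exprn_ge0 ?(ltW r0)//.
  rewrite ler_wpM2l ?powR_ge0//.
  rewrite -(powR_mulrn n (ltW t_gt0)) -(powR_mulrn n (ler0n R 2)) -powRN -!powRrM.
  by rewrite mulNr mulrC mulNr.
have h1 : (m x (s / 2) - m x s) * (1 - t) <= D * A x r * (t ^+ n * (1 - t)).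
  rewrite [leRHS]mulrA ler_wpM2r ?subr_ge0 ?(ltW t_lt1)//.
  apply: le_trans (essi_half x s0) _.
  by rewrite -mulrA ler_wpM2l// (le_trans ler01).
apply: le_trans (_ : _ <= (m x (s / 2) - m x s) * (1 - t) + (m x s - m x r) * (1 - t)) _.
  by rewrite -mulrDl addrA subrK.
apply: le_trans (lerD h1 IH) _.
by rewrite -mulrDr mulrBr mulr1 addrC addrA subrK -exprSr.
Qed.

(** On [Q] the excess over [eball x0 r] is at most the excess over the small ball around [z] plus
    the difference of the infima. The norm controls the integral of the first, and [essi_chain]
    bounds the second by [K1]. *)
Lemma integral_excess_cell_le x0 r z n (Q : set E) (M K1 : R) :
  0 < r -> eball x0 r z -> measurable Q ->
  Q `<=` eball z (2 * r / 2 ^+ n) -> A z (2 * r) <= M ->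
  K1 = D * M / (1 - t) ->
  (\int[mu]_(y in Q `&` eball x0 r) (excess (eball x0 r) f y)%:E <=
   (M * vol z (2 * r / 2 ^+ n))%:E + K1%:E * mu Q)%E.
Proof.
move=> r0 Bz mQ QB AM K1E; set B := eball x0 r; set s := 2 * r / 2 ^+ n.
have r20 : 0 < 2 * r by rewrite mulr_gt0.
have s0 : 0 < s by rewrite divr_gt0// exprn_gt0.
have t1 : 0 < 1 - t by rewrite subr_gt0.
have M0 : 0 <= M by exact: le_trans (A_ge0 z r20) AM.
have D0 : 0 <= D by exact: le_trans ler01 D_ge1.
have K10 : 0 <= K1 by rewrite K1E divr_ge0 ?mulr_ge0// ltW.
have mQB : measurable (Q `&` B) by apply: measurableI => //; exact: mB.
(* Since [eball x0 r] lies in [eball z (2 * r)], the infimum over the latter is the smaller one, and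
   the chain can start from radius [2 * r]. *)
have mK : m z s - essi B f <= K1.
  apply: (@le_trans _ _ (m z s - m z (2 * r))).
    rewrite lerD2l lerN2; apply: le_m; rewrite ?osc_ess_inf_fin//.
    move=> y By; rewrite /eball/=; apply: (eball_half_trans (y := x0)) => //.
    by rewrite edistC.
  apply: le_trans (essi_chain z n r20) _.
  by rewrite K1E ler_pM2r ?invr_gt0// ler_wpM2l.
have mex y' s' S : 0 < s' -> measurable S ->
    measurable_fun (eball y' s') (fun y => (excess S f y)%:E).
  by move=> s'0 mS; apply/measurable_EFinP; apply: measurable_excess => //; exact: mf.
apply: (@le_trans _ _ (\int[mu]_(y in Q `&` B) ((excess (eball z s) f y)%:E + K1%:E))%E).
  apply: ge0_le_integral => //.
  - by move=> y _; rewrite lee_fin excess_ge0.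
  - by apply: measurable_funS (mex _ _ _ r0 (mB x0 r)) => //; exact: subIsetr.
  - apply: emeasurable_funD => //; apply: measurable_funS (mex _ _ _ s0 (mB z s)) => //.
    by move=> y [Qy _]; exact: QB.
  - move=> y _; rewrite -EFinD lee_fin /excess ge_max addr_ge0 ?excess_ge0// andbT.
    have : f y - m z s <= Num.max (f y - essi (eball z s) f) 0 by rewrite le_max lexx.
    by move: mK; rewrite /m; lra.
rewrite ge0_integralD//; last 2 first.
- by move=> y _; rewrite lee_fin excess_ge0.
- apply: measurable_funS (mex _ _ _ s0 (mB z s)) => //.
  by move=> y [Qy _]; exact: QB.
rewrite integral_cst//; apply: leeD.
  apply: (@le_trans _ _ (\int[mu]_(y in eball z s) (excess (eball z s) f y)%:E)%E).
    apply: ge0_subset_integral => //.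
    - exact: mex.
    - by move=> y _; rewrite lee_fin excess_ge0.
    - by move=> y [/QB].
  apply: le_trans (integral_excess_le z s0) _.
  rewrite lee_fin ler_wpM2r ?(ltW (vol_gt0 _ _ _))//.
  apply: le_trans AM; apply: le_A => //.
  by rewrite ler_pdivrMr ?exprn_gt0// ler_peMr ?(ltW r20)// exprn_ege1// ler1n.
by rewrite lee_wpmul2l ?lee_fin// le_measure ?inE//; exact: subIsetl.
Qed.

(** The measure with density [excess] on the ball is compared with [K] times Lebesgue measure, first
    on cells and hence on all Borel sets; then the set where the excess is larger than [K] must be
    null. *)
Lemma osc_class_ae_le x0 r (M : R) : 0 < r ->
  (forall z, eball x0 r z -> A z (2 * r) <= M) ->
  \forall y \ae mu, eball x0 r y ->
    excess (eball x0 r) f y <= D * (1 + (1 - t)^-1) * M.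
Proof.
move=> r0 AM; set B := eball x0 r; set K := D * _ * M.
have d1 : 0 < d%:R :> R by rewrite ltr0n.
have r20 : 0 < 2 * r by rewrite mulr_gt0.
have t1 : 0 < 1 - t by rewrite subr_gt0.
have M0 : 0 <= M by apply: le_trans (AM x0 (eball_center x0 r0)); exact: A_ge0.
have D0 : 0 <= D by exact: le_trans ler01 D_ge1.
have K0 : 0 <= K by rewrite !mulr_ge0// addr_ge0// invr_ge0 ltW.
pose g := (fun y => (excess B f y)%:E) \_ B.
have mex : measurable_fun B (fun y => (excess B f y)%:E).
  by apply/measurable_EFinP; apply: measurable_excess; [exact: mB|exact: (@mf x0 r r0)].
have mg : measurable_fun setT g.
  by apply: ((measurable_restrictT _ (mB x0 r)).1 mex).
have g0 y : (0 <= g y)%E.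
  by rewrite /g patchE; case: ifP => // _; rewrite lee_fin excess_ge0.
(* With this mesh a cell of generation [n] lies in the ball of radius [2 * r / 2 ^+ n] around each
   of its points. *)
pose a := 2 * r / d%:R; have a0 : 0 < a by rewrite divr_gt0.
have nu_setI S : density_measure mu g0 mg S = (\int[mu]_(y in S `&` B) (excess B f y)%:E)%E.
  by rewrite integral_mkcondr.
(* Restricting Lebesgue measure to [eball x0 (4 * r)] makes it finite and still keeps every cell
   that meets [B] whole. *)
have le_mu S : measurable S ->
    (density_measure mu g0 mg S <= mscale (NngNum K0) (mrestr mu (mB x0 (4 * r))) S)%E.
  move=> mS; apply: (le_measure_dyadic a0) => //.
  - suff : (density_measure mu g0 mg setT < +oo)%E by [].
    rewrite nu_setI setTI; apply: le_lt_trans (integral_excess_le x0 r0) _.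
    exact: ltry.
  - suff : (K%:E * mu (setT `&` eball x0 (4 * r)) < +oo)%E by [].
    by rewrite setTI lebesgue_eballE ?mulr_gt0// -EFinM ltry.
  move=> n k; set Q := dyadic_cell a n k.
  suff : (density_measure mu g0 mg Q <= K%:E * mu (Q `&` eball x0 (4 * r)))%E by [].
  have mQ : measurable Q by exact: measurable_dyadic_cell.
  have [[z [Qz Bz]]|QB0] := pselect (exists z, Q z /\ B z); last first.
    rewrite nu_setI (_ : Q `&` B = set0) ?integral_set0.
      by rewrite mule_ge0 ?lee_fin.
    by rewrite -subset0 => z [Qz Bz]; apply: QB0; exists z.
  have Qsub : Q `<=` eball z (2 * r / 2 ^+ n).
    apply: subset_trans (cube_sub_eball d_gt0 (divr_gt0 r20 _)); last by rewrite exprn_gt0.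
    rewrite /Q -Qz (_ : _ / d%:R = a / 2 ^+ n); last by rewrite /a mulrAC.
    exact: dyadic_cell_sub_cube.
  rewrite nu_setI; apply: le_trans (integral_excess_cell_le r0 Bz mQ Qsub (AM z Bz) erefl) _.
  have -> : Q `&` eball x0 (4 * r) = Q.
    apply/setIidPl.
    apply: subset_trans Qsub _ => y zy; rewrite (_ : 4 * r = 2 * (2 * r)); last by ring.
    apply: (eball_half_trans (y := z)) => //; first by move: Bz; rewrite /B /eball/=; lra.
    apply: lt_le_trans zy _.
    by rewrite ler_pdivrMr ?exprn_gt0// ler_peMr ?(ltW r20)// exprn_ege1// ler1n.
  have Qge := lebesgue_dyadic_cell_ge a0 n k.
  have Qfin : mu Q \is a fin_num.
    rewrite ge0_fin_numE//; apply: le_lt_trans (_ : mu Q <= mu (eball z (2 * r / 2 ^+ n)))%E _.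
      by rewrite le_measure ?inE.
    by rewrite lebesgue_eballE ?divr_gt0 ?exprn_gt0// ltry.
  move: Qge; rewrite -/Q -(fineK Qfin) -!EFinM -EFinD !lee_fin => Qge.
  (* The same [D] compares ball and cell, since 2 d times the side of the cell is twice the radius
     of the ball. The two terms then add up to exactly [K] times the measure of the cell. *)
  have : vol z (2 * r / 2 ^+ n) <= D * fine (mu Q).
    apply: le_trans (ler_wpM2l D0 Qge); apply: le_trans (vol_le z _) _.
      by rewrite divr_gt0// exprn_gt0.
    rewrite /D -exprMn (_ : 2 * d%:R * _ = 2 * (2 * r / 2 ^+ n))// /a.
    by field; rewrite expf_neq0 ?pnatr_eq0//= -lt0n d_gt0.
  move=> /(ler_wpM2l M0) h; rewrite /K; apply: le_trans (lerD h (lexx _)) _.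
  by rewrite le_eqVlt; apply/orP; left; apply/eqP; ring.
pose S := B `&` [set y | K < excess B f y].
have mS : measurable S.
  have /measurable_EFinP := mex; rewrite /S => h.
  have := h (mB x0 r) _ (measurable_itv `]K, +oo[).
  congr measurable; congr (_ `&` _); apply/seteqP; split=> y /=; rewrite in_itv/= andbT//.
have SB : S `&` B = S by apply/setIidPl; exact: subIsetl.
have mexS : measurable_fun S (fun y => (excess B f y)%:E).
  by apply: measurable_funS mex => //; [exact: mB|exact: subIsetl].
pose h y := (excess B f y - K)%:E.
have mh : measurable_fun S h.
  by apply/measurable_EFinP; apply: measurable_funB => //; exact/measurable_EFinP.
have Sfin : (mu S < +oo)%E.
  apply: le_lt_trans (_ : mu S <= mu B)%E _; last by rewrite lebesgue_eballE// ltry.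
  by rewrite le_measure ?inE//; [exact: mB|exact: subIsetl].
have int0 : (\int[mu]_(y in S) `|h y| = 0)%E.
  have h0 y : S y -> (0 <= h y)%E by move=> [_ /= Ky]; rewrite lee_fin subr_ge0 ltW.
  apply/eqP; rewrite eq_le integral_ge0// andbT.
  have -> : (\int[mu]_(y in S) `|h y| = \int[mu]_(y in S) h y)%E.
    by apply: eq_integral => y /set_mem Sy; rewrite gee0_abs// h0.
  (* Finiteness of [K%:E * mu S] allows it to be added to both sides; the claim becomes that the
     excess integrates over [S] to at most this number. *)
  have Kfin : (K%:E * mu S)%E \is a fin_num by rewrite fin_numM// ge0_fin_numE.
  rewrite -(leeD2rE _ _ Kfin) add0e -[X in (_ + X)%E](integral_cst mu mS) -ge0_integralD//.
  rewrite (_ : (\int[mu]_(y in S) _)%E = (\int[mu]_(y in S `&` B) (excess B f y)%:E)%E).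
    rewrite -nu_setI; apply: le_trans (le_mu S mS) _.
    rewrite /mscale/= lee_wpmul2l ?lee_fin// /mrestr; apply: le_measure; rewrite ?inE//.
    by apply: measurableI => //; exact: mB.
  by rewrite SB; apply: eq_integral => y _; rewrite /h -EFinD subrK.
have := (ae_eq_integral_abs mu mS mh).1 int0.
apply: filterS => y hy By; rewrite leNgt; apply/negP => Ky.
have [/subr0_eq yK] := hy (conj By Ky).
by move: Ky; rewrite yK ltxx.
Qed.

End oscillation.

(** * Averages *)


Section averages.
Context (R : realType) (d : nat).
Local Notation E := (d.-tuple R).
Local Notation mu := (lebesgue_tuple R d).
Variable B : set E.
Hypotheses (mB : measurable B) (B_gt0 : (0 < mu B)%E) (B_fin : (mu B < +oo)%E).
Implicit Types (F G : E -> R) (a b p q : R).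
Local Open Scope ereal_scope.

Let v := fine (mu B).

Let muBE : mu B = v%:E.
Proof. by rewrite fineK// ge0_fin_numE. Qed.

Let v_gt0 : (0 < v)%R.
Proof. by rewrite -lte_fin -muBE. Qed.

Let muBV : (mu B)^-1 = (v^-1)%:E.
Proof. by rewrite muBE inver gt_eqF. Qed.

Lemma avgE (h : E -> \bar R) : avg B h = (v^-1)%:E * \int[mu]_(y in B) h y.
Proof. by rewrite /avg muBV. Qed.

Lemma avg_ge0 (h : E -> \bar R) : (forall x, B x -> 0 <= h x) -> 0 <= avg B h.
Proof.
by move=> h0; rewrite avgE mule_ge0 ?lee_fin ?invr_ge0 ?(ltW v_gt0)// integral_ge0.
Qed.

Lemma integral_pos (h : E -> \bar R) : measurable_fun B h ->
  (forall x, B x -> 0 <= h x) -> (\forall x \ae mu, B x -> 0 < h x) ->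
  0 < \int[mu]_(y in B) h y.
Proof.
move=> mh h0 hpos; rewrite lt0e integral_ge0// andbT; apply/eqP => int0.
have : \int[mu]_(y in B) `|h y| = 0.
  by rewrite -int0; apply: eq_integral => y /set_mem By; rewrite gee0_abs// h0.
move=> /(ae_eq_integral_abs mu mB mh) h00.
move: B_gt0; rewrite ae_false ?ltxx//.
apply: filterS2 h00 hpos => x e1 e2 Bx.
by have := e2 Bx; rewrite e1// ltxx.
Qed.

Lemma avg_gt0 (h : E -> \bar R) : measurable_fun B h ->
  (forall x, B x -> 0 <= h x) -> (\forall x \ae mu, B x -> 0 < h x) ->
  0 < avg B h.
Proof.
by move=> *; rewrite avgE mule_gt0 ?lte_fin ?invr_gt0// integral_pos.
Qed.

Lemma avg_lty (h : E -> \bar R) : (forall x, B x -> 0 <= h x) ->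
  (avg B h < +oo) -> \int[mu]_(y in B) h y < +oo.
Proof.
move=> h0; rewrite avgE; apply: contraTT; rewrite -!leNgt !leye_eq => /eqP ->.
by rewrite gt0_muley// lte_fin invr_gt0.
Qed.

Lemma hoelder_avg F G a b : measurable_fun B F -> measurable_fun B G ->
  (forall x, B x -> 0 <= F x)%R -> (forall x, B x -> 0 <= G x)%R ->
  (0 < a)%R -> (0 < b)%R -> (a^-1 + b^-1 = 1)%R ->
  avg B (fun y => (F y * G y)%:E) <=
  avg B (fun y => (F y `^ a)%:E) `^ a^-1 * avg B (fun y => (G y `^ b)%:E) `^ b^-1.
Proof.
move=> mF mG F0 G0 a0 b0 ab.
have mF' : measurable_fun setT (F \_ B) by apply: ((measurable_restrictT _ mB).1 mF).
have mG' : measurable_fun setT (G \_ B) by apply: ((measurable_restrictT _ mB).1 mG).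
have restr (H : E -> R) c : (0 < c)%R -> (forall x, B x -> 0 <= H x)%R ->
    \int[mu]_x (`|(EFin \o (H \_ B)) x| `^ c) = \int[mu]_(y in B) (H y `^ c)%:E.
  move=> c0 H0; rewrite [RHS]integral_mkcond; apply: eq_integral => x _.
  rewrite /patch /=; case: ifPn => [/set_mem Bx|_] /=.
    by rewrite ger0_norm// H0.
  by rewrite normr0 powR0// gt_eqF.
have := hoelder mu mF' mG' a0 b0 ab.
rewrite Lnorm1 unlock !restr//.
have -> : \int[mu]_x `|(EFin \o (F \_ B \* G \_ B)%R) x| =
    \int[mu]_(y in B) (F y * G y)%:E.
  rewrite [RHS]integral_mkcond; apply: eq_integral => x _.
  rewrite /patch /=; case: ifPn => [/set_mem Bx|_] /=; last by rewrite mulr0 normr0.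
  by rewrite ger0_norm// mulr_ge0 ?F0 ?G0.
move=> h; rewrite !avgE.
have i0 (H : E -> R) c : 0 <= \int[mu]_(y in B) (H y `^ c)%:E.
  by apply: integral_ge0 => y _; rewrite lee_fin powR_ge0.
have vi0 : 0 <= (v^-1)%:E by rewrite lee_fin invr_ge0 ltW.
(* The factor 1/|B| is distributed over the two means because the exponents 1/a and 1/b sum to 1. *)
rewrite !poweRM// muleACA -poweRD; last by apply: add_neq0_poweRD_def; rewrite ab oner_eq0.
by rewrite ab poweRe1// lee_wpmul2l.
Qed.

Lemma avg_cst1 : avg B (cst 1) = 1.
Proof.
rewrite avgE integral_cst// mul1e; transitivity ((v^-1)%:E * v%:E).
  by congr (_ * _); exact: muBE.
by rewrite -EFinM mulVf// gt_eqF.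
Qed.

(** Hoelder's inequality for the power [p] of [F] against the constant 1, with exponent [q / p] and
    its conjugate. *)
Lemma power_mean_le F p q : measurable_fun B F -> (forall x, B x -> 0 <= F x)%R ->
  (0 < p)%R -> (p < q)%R ->
  avg B (fun y => (F y `^ p)%:E) `^ p^-1 <= avg B (fun y => (F y `^ q)%:E) `^ q^-1.
Proof.
move=> mF F0 p0 pq; have q0 := lt_trans p0 pq.
pose a := (q / p)%R; pose b := (q / (q - p))%R.
have qp0 : (0 < q - p)%R by rewrite subr_gt0.
have a0 : (0 < a)%R by rewrite divr_gt0.
have b0 : (0 < b)%R by rewrite divr_gt0.
have ab : (a^-1 + b^-1 = 1)%R by rewrite /a /b; field; rewrite !gt_eqF.
have mFp : measurable_fun B (fun y => F y `^ p)%R.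
  exact: (measurableT_comp (measurable_powR p) mF).
have := hoelder_avg mFp (@measurable_cst _ _ _ _ B (1 : R)%R)
  (fun x _ => powR_ge0 _ _) (fun x _ => ler01) a0 b0 ab.
under eq_fun do rewrite mulr1.
under [X in _ <= avg _ X `^ _ * _]eq_fun do rewrite -powRrM.
under [X in _ <= _ * avg _ X `^ _]eq_fun do rewrite powR1.
rewrite (avg_cst1) poweR1r mule1 (_ : p * a = q)%R; last first.
  by rewrite /a; field; rewrite gt_eqF.
set X := avg B _; set Y := avg B _ => h.
have X0 : 0 <= X by apply: avg_ge0 => x _; rewrite lee_fin powR_ge0.
have Y0 : 0 <= Y by apply: avg_ge0 => x _; rewrite lee_fin powR_ge0.
apply: le_trans (_ : (Y `^ a^-1) `^ p^-1 <= _).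
  by apply: gt0_ler_poweR => //; rewrite ?in_itv/= ?leey ?andbT ?poweR_ge0// invr_ge0 ltW.
by rewrite -poweRrM (_ : _ * _ = q^-1)%R// /a; field; rewrite !gt_eqF.
Qed.

End averages.

(** * Weights *)


Section weights.
Context (R : realType) (d : nat).
Hypothesis d_gt0 : (0 < d)%N.
Local Notation E := (d.-tuple R).
Local Notation mu := (lebesgue_tuple R d).
Variables (rho : E -> R) (theta p q : R) (w : E -> R).
Hypotheses (rho_gt0 : forall x, 0 < rho x) (p_ge1 : 1 <= p) (pq : p < q)
  (w_Apq : Apq_class rho theta p q w).
Implicit Types (x y : E) (r : R) (e : E -> R).

Let mB := @measurable_eball R d.
Let w_ge0 y : 0 <= w y. Proof. by have [[]] := w_Apq. Qed.

Lemma weight_measurable x r : 0 < r -> measurable_fun (eball x r) w.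
Proof. by move=> r0; apply: measurable_fun_loc => //; have [[]] := w_Apq. Qed.

Lemma lebesgue_eball_lty x r : 0 < r -> (mu (eball x r) < +oo)%E.
Proof. by move=> r0; rewrite lebesgue_eballE// ltry. Qed.

Let B_gt0 := @lebesgue_eball_gt0 R d d_gt0.

Local Open Scope ereal_scope.

Let dual_fun b y := ((w y)%:E)^-1 `^ b.

Let measurable_dual x r b : (0 < r)%R -> (0 < b)%R ->
  measurable_fun (eball x r) (dual_fun b).
Proof.
move=> r0 b0.
(* The zeros of [w] are split off: there the extended inverse is [+oo], elsewhere a real power. *)
have -> : dual_fun b =
    (fun t : R => if t == 0%R then +oo else ((t `^ (- b))%R)%:E) \o w.
  apply/funext => y; rewrite /dual_fun /= inver; case: ifP => [_|_].
    by rewrite poweRyr// gt_eqF.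
  by rewrite poweR_EFin -powR_inv1// -powRrM mulN1r.
apply: measurableT_comp; last exact: weight_measurable.
apply: measurable_fun_ifT; [exact: measurable_fun_eqr|exact: measurable_cst|].
by apply/measurable_EFinP; exact: measurable_powR.
Qed.

Let dual_fun_gt0 b y : 0 < dual_fun b y.
Proof.
rewrite /dual_fun inver; case: ifPn => [_|w0]; apply: poweR_gt0 => //.
by rewrite lte_fin invr_gt0 lt0r w0 w_ge0.
Qed.

Let p_gt0 : (0 < p)%R. Proof. exact: lt_le_trans p_ge1. Qed.
Let q_gt0 : (0 < q)%R. Proof. exact: lt_trans pq. Qed.

Let conj_gt0 : p != 1%R -> (0 < p / (p - 1))%R.
Proof. by move=> p1; rewrite divr_gt0// subr_gt0 lt_neqAle eq_sym p1. Qed.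

Let dual_mean_lty x r : (0 < r)%R -> dual_mean p w (eball x r) < +oo.
Proof. by move=> r0; have [_ /(_ x r r0)[]] := w_Apq. Qed.

Lemma weight_ess_inf_ge0 x r : 0 <= ess_inf_on (eball x r) w.
Proof. by apply/ess_inf_onP; apply: aeW => y _; rewrite lee_fin w_ge0. Qed.

Let ess_inf_gt0 x r : (0 < r)%R -> p = 1%R -> 0 < ess_inf_on (eball x r) w.
Proof.
move=> r0 p1; have := dual_mean_lty x r0; rewrite /dual_mean p1 eqxx.
by rewrite lt0e weight_ess_inf_ge0 andbT; apply: contraTneq => ->; rewrite inve0.
Qed.

(** Finiteness of the dual mean forbids zeros on a set of positive measure: for [p = 1] the
    essential infimum is positive, otherwise an integrable function that is [+oo] at the zeros is
    finite almost everywhere. *)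
Lemma weight_ae_gt0 x r : (0 < r)%R ->
  \forall y \ae mu, eball x r y -> (0 < w y)%R.
Proof.
move=> r0; have [p1|p1] := eqVneq p 1%R.
  apply: filterS (ess_inf_on_le (eball x r) w) => y /[apply] h.
  by rewrite -lte_fin; apply: lt_le_trans h; exact: ess_inf_gt0.
have := dual_mean_lty x r0; rewrite /dual_mean (negbTE p1) => dm.
have b0 := conj_gt0 p1; set b := (p / (p - 1))%R in dm b0.
have {}dm : \int[mu]_(y in eball x r) dual_fun b y < +oo.
  apply: (avg_lty (B_gt0 x r0) (lebesgue_eball_lty x r0)).
    by move=> y _; exact/ltW/dual_fun_gt0.
  by apply: lty_poweRy dm; rewrite invr_eq0 gt_eqF.
have int : mu.-integrable (eball x r) (dual_fun b).
  apply/integrableP; split; first exact: measurable_dual.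
  rewrite (eq_integral (dual_fun b))// => y _; rewrite gee0_abs//.
  exact/ltW/dual_fun_gt0.
apply: filterS (integrable_ae (mB x r) int) => y /[apply].
rewrite /dual_fun inver; case: ifPn => [_|w0 _]; first by rewrite poweRyr ?gt_eqF.
by rewrite lt0r w0 w_ge0.
Qed.

(** Write [e] as [e * w] times the inverse of [w] and apply Hoelder with [p] and its conjugate; for
    [p = 1] bound the inverse by that of the essential infimum. *)
Lemma avg_le_dual x r e : (0 < r)%R -> measurable_fun (eball x r) e ->
  (forall y, eball x r y -> 0 <= e y)%R ->
  avg (eball x r) (fun y => (e y)%:E) <=
  avg (eball x r) (fun y => ((e y * w y) `^ p)%:E) `^ p^-1 *
  dual_mean p w (eball x r).
Proof.
move=> r0 me e0; set B := eball x r.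
have [[mBx B0] Boo] := (mB x r, B_gt0 x r0, lebesgue_eball_lty x r0).
have mw := @weight_measurable x r r0.
have mew : measurable_fun B (fun y => e y * w y)%R by exact: measurable_funM.
rewrite /dual_mean; case: ifPn => [/eqP p1|p1].
  have c0 := ess_inf_gt0 x r0 p1.
  have cfin : ess_inf_on B w \is a fin_num.
    by rewrite ge0_fin_numE ?weight_ess_inf_ge0// ess_inf_on_lty.
  move: c0; rewrite -(fineK cfin) lte_fin => c0.
  set c := fine _ in c0 *.
  rewrite p1 invr1 poweRe1; last by apply: avg_ge0 => // y _; rewrite lee_fin powR_ge0.
  rewrite inver gt_eqF// !avgE// -muleA lee_wpmul2l ?lee_fin ?invr_ge0 ?fine_ge0//.
  rewrite muleC -ge0_integralZl//; last 3 first.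
  - apply/measurable_EFinP.
    exact: (measurableT_comp (measurable_powR 1) mew).
  - by move=> y _; rewrite lee_fin powR_ge0.
  - by rewrite lee_fin invr_ge0 ltW.
  apply: ae_ge0_le_integral => //.
  - exact/measurable_EFinP.
  - by move=> y _; rewrite mule_ge0 ?lee_fin ?powR_ge0// invr_ge0 ltW.
  - apply: measurable_funeM; apply/measurable_EFinP.
    exact: (measurableT_comp (measurable_powR 1) mew).
  apply: filterS (ess_inf_on_le B w) => y /[swap] By /(_ By) h.
  rewrite -EFinM lee_fin powRr1 ?mulr_ge0 ?e0//.
  by rewrite mulrC ler_pdivlMr// ler_wpM2l ?e0// -lee_fin fineK.
set b := (p / (p - 1))%R; have b0 : (0 < b)%R by exact: conj_gt0.
have pb : (p^-1 + b^-1 = 1)%R.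
  by rewrite /b; field; rewrite subr_eq0 p1 gt_eqF.
have mwi : measurable_fun B (fun y => w y `^ (-1))%R.
  exact: (measurableT_comp (measurable_powR (-1)) mw).
have := hoelder_avg mBx B0 Boo mew mwi _ (fun y _ => powR_ge0 _ _) p_gt0 b0 pb.
move=> /(_ (fun y By => mulr_ge0 (e0 y By) (w_ge0 y))).
have -> : avg B (fun y => (e y * w y * w y `^ (-1))%:E) = avg B (fun y => (e y)%:E).
  congr (_ * _); apply: ae_eq_integral => //.
  - by apply/measurable_EFinP; exact: measurable_funM.
  - exact/measurable_EFinP.
  apply: filterS (weight_ae_gt0 x r0) => y /[apply] w0.
  by rewrite powR_inv1 ?(ltW w0)// mulfK// gt_eqF.
(* Real and extended inverses differ only at zeros of [w], a null set. *)
have -> : avg B (fun y => ((w y `^ (-1)) `^ b)%:E) = avg B (dual_fun b).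
  congr (_ * _); apply: ae_eq_integral => //.
  - by apply/measurable_EFinP; exact: (measurableT_comp (measurable_powR b) mwi).
  - exact: measurable_dual.
  apply: filterS (weight_ae_gt0 x r0) => y /[apply] w0.
  by rewrite /dual_fun inver gt_eqF// poweR_EFin powR_inv1 ?(ltW w0).
by [].
Qed.

Lemma weight_integral_gt0 x r : (0 < r)%R ->
  0 < \int[mu]_(y in eball x r) (w y `^ q)%:E.
Proof.
move=> r0; apply: (integral_pos (mB x r) (B_gt0 x r0)).
- apply/measurable_EFinP.
  exact: (measurableT_comp (measurable_powR q) (@weight_measurable x r r0)).
- by move=> y _; rewrite lee_fin powR_ge0.
- by apply: filterS (weight_ae_gt0 x r0) => y /[apply] w0; rewrite lte_fin powR_gt0.
Qed.

Lemma weight_integral_lty x r : (0 < r)%R ->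
  \int[mu]_(y in eball x r) (w y `^ q)%:E < +oo.
Proof.
move=> r0; apply: (avg_lty (B_gt0 x r0) (lebesgue_eball_lty x r0)).
  by move=> y _; rewrite lee_fin powR_ge0.
have [_ /(_ x r r0)[+ _] _] := w_Apq.
by apply: lty_poweRy; rewrite invr_eq0 gt_eqF.
Qed.

Lemma dual_mean_ge0 x r : (0 < r)%R -> 0 <= dual_mean p w (eball x r).
Proof.
move=> r0; rewrite /dual_mean; case: ifPn => [_|_]; last exact: poweR_ge0.
by rewrite inve_ge0 weight_ess_inf_ge0.
Qed.

Lemma dual_mean_gt0 x r : (0 < r)%R -> 0 < dual_mean p w (eball x r).
Proof.
move=> r0; rewrite /dual_mean; case: ifPn => [/eqP p1|p1].
  have c0 := ess_inf_gt0 x r0 p1.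
  by rewrite inve_gt0 ?(gt_eqF c0) ?(lt_eqF (ess_inf_on_lty _ (mB x r) (B_gt0 x r0))).
have b0 := conj_gt0 p1.
apply: poweR_gt0; apply: (avg_gt0 (mB x r) (B_gt0 x r0) (lebesgue_eball_lty x r0)).
- exact: measurable_dual.
- by move=> y _; exact/ltW/dual_fun_gt0.
- by apply: aeW => y _; exact: dual_fun_gt0.
Qed.

Lemma weight_mean_gt0 x r : (0 < r)%R -> 0 < weight_mean q w (eball x r).
Proof.
move=> r0; apply: poweR_gt0.
rewrite (avgE (B_gt0 x r0) (lebesgue_eball_lty x r0)) mule_gt0 ?weight_integral_gt0//.
by rewrite lte_fin invr_gt0 -lte_fin fineK ?lebesgue_eball_fin ?B_gt0.
Qed.

Lemma le_Apq_const x r : (0 < r)%R ->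
  weight_mean q w (eball x r) * dual_mean p w (eball x r) <=
  growth rho x r theta * Apq_const rho theta p q w.
Proof.
move=> r0; have g0 : (0 < gr rho x r theta)%R by rewrite gr_gt0// ltW.
rewrite growthE -lee_pdivrMl// muleA -grN -growthE.
by apply: ereal_sup_ubound; exists x, r.
Qed.

(** Together with finiteness, this allows constants to be rescaled by the constant of the weight. *)
Lemma Apq_const_gt0 : 0 < Apq_const rho theta p q w.
Proof.
pose x : E := [tuple 0%R | i < d].
have g0 : (0 < gr rho x 1 theta)%R by rewrite gr_gt0.
rewrite -(@lte_pmul2l _ (growth rho x 1 theta)) ?growthE ?lte_fin// mule0.
apply: lt_le_trans (le_Apq_const x ltr01).
by rewrite mule_gt0 ?weight_mean_gt0 ?dual_mean_gt0.
Qed.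

Lemma Apq_const_fin : Apq_const rho theta p q w \is a fin_num.
Proof. by rewrite ge0_fin_numE ?(ltW Apq_const_gt0)//; have [] := w_Apq. Qed.

End weights.

(** * Weighted oscillation *)


Section main.
Context (R : realType) (d : nat).
Hypothesis d_gt0 : (0 < d)%N.
Local Notation E := (d.-tuple R).
Local Notation mu := (lebesgue_tuple R d).
Variables (rho : E -> R) (p q beta theta2 : R) (w : E -> R).
Hypotheses (rho_gt0 : forall x, 0 < rho x) (p_ge1 : 1 <= p) (pq : p < q)
  (beta_gt0 : 0 < beta) (w_Apq : Apq_class rho theta2 p q w).
Implicit Types (x y : E) (r : R) (f : E -> R).

Let mB := @measurable_eball R d.
Let B_gt0 := @lebesgue_eball_gt0 R d d_gt0.
Let w_ge0 y : 0 <= w y. Proof. by have [[]] := w_Apq. Qed.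
Let mw := @weight_measurable R d rho theta2 p q w w_Apq.
Let W_gt0 := weight_integral_gt0 d_gt0 p_ge1 w_Apq.
Let W_lty := weight_integral_lty d_gt0 p_ge1 pq w_Apq.

Local Open Scope ereal_scope.

Let q_gt0 : (0 < q)%R. Proof. exact: lt_trans (lt_le_trans ltr01 p_ge1) pq. Qed.

Let W x r : R := fine (\int[mu]_(y in eball x r) (w y `^ q)%:E).

Let WE x r : (0 < r)%R -> \int[mu]_(y in eball x r) (w y `^ q)%:E = (W x r)%:E.
Proof. by move=> r0; rewrite fineK// ge0_fin_numE ?W_lty// ltW// W_gt0. Qed.

Let W0 x r : (0 < r)%R -> (0 < W x r)%R.
Proof. by move=> r0; rewrite -lte_fin -WE// W_gt0. Qed.

Let osc_int f x r := \int[mu]_(y in eball x r)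
  ((excess (eball x r) f y * w y) `^ q)%:E.

Lemma weighted_oscE f x r : (0 < r)%R -> measurable_fun (eball x r) f ->
  ess_inf_on (eball x r) f \is a fin_num ->
  weighted_osc beta q w f (eball x r) =
  ((vol x r `^ (beta / d%:R))^-1)%:E * (((W x r)^-1)%:E * osc_int f x r) `^ q^-1.
Proof.
move=> r0 mf fin; rewrite /weighted_osc WE// inver gt_eqF ?W0//.
rewrite lebesgue_eballE// poweR_EFin inver gt_eqF ?powR_gt0 ?vol_gt0//.
congr (_ * (_ * _) `^ _); apply: ae_eq_integral => //.
- apply: emeasurable_funM; last first.
    apply/measurable_EFinP; exact: (measurableT_comp (measurable_powR q) (mw r0)).
  apply: (measurableT_comp (measurable_poweR q)).
  rewrite -(fineK fin); apply/measurable_EFinP.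
  exact: measurable_funB.
- apply/measurable_EFinP; apply: (measurableT_comp (measurable_powR q)).
  by apply: measurable_funM; [exact: measurable_excess|exact: mw].
apply: filterS (ae_excess fin) => y /[apply] ->.
by rewrite poweR_EFin -EFinM powRM ?excess_ge0.
Qed.

(** The pointwise bound comes out of the integral, and what remains cancels against the
    normalization by the mass of the ball. *)
Lemma weighted_osc_le f x r (K : R) : (0 < r)%R -> (0 <= K)%R ->
  measurable_fun (eball x r) f -> ess_inf_on (eball x r) f \is a fin_num ->
  (\forall y \ae mu, eball x r y -> (excess (eball x r) f y <= K)%R) ->
  weighted_osc beta q w f (eball x r) <= (K / vol x r `^ (beta / d%:R))%:E.
Proof.
move=> r0 K0 mf fin hK; rewrite weighted_oscE// (mulrC K) EFinM.
have vb : (0 < vol x r `^ (beta / d%:R))%R by rewrite powR_gt0// vol_gt0.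
rewrite lee_wpmul2l ?lee_fin ?invr_ge0 ?(ltW vb)//.
have mew : measurable_fun (eball x r)
    (fun y => ((excess (eball x r) f y * w y) `^ q)%:E).
  apply/measurable_EFinP; apply: (measurableT_comp (measurable_powR q)).
  by apply: measurable_funM; [exact: measurable_excess|exact: mw].
have mwq : measurable_fun (eball x r) (fun y => (w y `^ q)%:E).
  apply/measurable_EFinP; exact: (measurableT_comp (measurable_powR q) (mw r0)).
have h : osc_int f x r <= (K `^ q * W x r)%:E.
  rewrite EFinM -WE// -ge0_integralZl//; last 2 first.
  - by move=> y _; rewrite lee_fin powR_ge0.
  - by rewrite lee_fin powR_ge0.
  apply: ae_ge0_le_integral => //.
  - by move=> y _; rewrite lee_fin powR_ge0.
  - by move=> y _; rewrite mule_ge0 ?lee_fin ?powR_ge0.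
  - exact: measurable_funeM.
  apply: filterS hK => y /[apply] h.
  rewrite -EFinM lee_fin powRM ?excess_ge0// ler_wpM2r ?powR_ge0//.
  by apply: ge0_ler_powR; rewrite ?nnegrE ?excess_ge0// ltW.
have i0 : 0 <= osc_int f x r by apply: integral_ge0 => y _; rewrite lee_fin powR_ge0.
have h' : ((W x r)^-1)%:E * osc_int f x r <= (K `^ q)%:E.
  by rewrite lee_pdivrMl ?W0// -EFinM [(W x r * _)%R]mulrC.
apply: (@le_trans _ _ ((K `^ q)%:E `^ q^-1)).
  apply: gt0_ler_poweR => //; rewrite ?invr_ge0 ?(ltW q_gt0)//.
    by rewrite in_itv/= leey andbT mule_ge0// lee_fin invr_ge0 ltW// W0.
  by rewrite in_itv/= leey andbT lee_fin powR_ge0.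
by rewrite poweR_EFin -powRrM mulfV ?gt_eqF// powRr1.
Qed.

(** Part (1) before the constant of the weight is inserted; the [C] found here depends only on [d],
    [beta], [C0] and [theta1]. *)
Lemma osc_class_weighted_osc_le (C0 N0 theta1 : R) : (1 <= C0)%R -> (0 < N0)%R ->
  (0 <= theta1)%R -> admissible_constants rho C0 N0 ->
  exists2 C : R, (0 < C)%R &
  forall f, osc_class rho beta theta1 f -> forall x0 r, (0 < r)%R ->
    weighted_osc beta q w f (eball x0 r) <=
    C%:E * growth rho x0 r ((N0 + 1) * theta1) * osc_norm rho beta theta1 f.
Proof.
move=> C01 N00 t10 adm; have C00 := lt_le_trans ltr01 C01.
have dR : (0 < d%:R :> R)%R by rewrite ltr0n.
have t1 : (0 < 1 - 2 `^ (- beta) :> R)%R.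
  by rewrite subr_gt0 powR_half_lt1.
set D : R := ((2 * d%:R) ^+ d * (1 + (1 - 2 `^ (- beta))^-1))%R.
have D0 : (0 < D)%R.
  by rewrite mulr_gt0 ?exprn_gt0 ?mulr_gt0// addr_gt0// invr_gt0.
(* The factors come from [osc_class_ae_le], from [gr_shift], and from comparing 4r with the side
   2r/d of the inscribed cube. *)
exists (D * (1 + 2 * C0) `^ theta1 * (2 * d%:R) `^ beta)%R.
  have c1 : (0 < 1 + 2 * C0)%R by rewrite addr_gt0// mulr_gt0.
  have d2 : (0 < 2 * d%:R :> R)%R by rewrite mulr_gt0.
  by rewrite (mulr_gt0 (mulr_gt0 D0 _))// powR_gt0.
move=> f f_osc x0 r r0.
have r20 : (0 < 2 * r)%R by rewrite mulr_gt0.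
have Nge0 := osc_norm_ge0 d_gt0 rho_gt0 f_osc.
have Nfin : osc_norm rho beta theta1 f \is a fin_num.
  by rewrite ge0_fin_numE//; case: f_osc.
rewrite -(fineK Nfin); set N := fine _.
have N_ge0 : (0 <= N)%R by exact: fine_ge0.
set G := gr rho x0 r ((N0 + 1) * theta1).
pose M := (N * ((1 + 2 * C0) `^ theta1 * G) * (2 * (2 * r)) `^ beta)%R.
have M0 : (0 <= M)%R by rewrite !mulr_ge0 ?powR_ge0.
have AM z : eball x0 r z ->
    (N * gr rho z (2 * r) theta1 * (2 * (2 * r)) `^ beta <= M)%R.
  move=> Bz; rewrite /M ler_wpM2r ?powR_ge0// ler_wpM2l//.
  exact: gr_shift adm Bz.
have K0 : (0 <= D * M)%R by rewrite mulr_ge0// ltW.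
have mf : measurable_fun (eball x0 r) f.
  by apply: measurable_fun_loc => //; case: f_osc.
have fin := osc_ess_inf_fin d_gt0 rho_gt0 f_osc x0 r0.
have := osc_class_ae_le d_gt0 rho_gt0 beta_gt0 t10 f_osc r0 AM.
move=> /(weighted_osc_le r0 K0 mf fin) /le_trans; apply.
rewrite growthE -!EFinM lee_fin -/G.
have v0 : (0 < vol x0 r `^ (beta / d%:R))%R by rewrite powR_gt0// vol_gt0.
have vb : ((2 * (r / d%:R)) `^ beta <= vol x0 r `^ (beta / d%:R))%R.
  apply: (@le_trans _ _ (((2 * (r / d%:R)) `^ d%:R) `^ (beta / d%:R))%R).
    by rewrite -powRrM (_ : d%:R * _ = beta)%R//; field; rewrite gt_eqF.
  have e0 : (0 <= 2 * (r / d%:R))%R by rewrite mulr_ge0// divr_ge0// ltW.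
  apply: ge0_ler_powR; rewrite ?nnegrE ?powR_ge0 ?divr_ge0 ?(ltW beta_gt0)//.
    exact/ltW/vol_gt0.
  by rewrite powR_mulrn// vol_ge.
rewrite ler_pdivrMr//.
apply: (@le_trans _ _ (D * (1 + 2 * C0) `^ theta1 * (2 * d%:R) `^ beta * G * N
   * (2 * (r / d%:R)) `^ beta)%R); last first.
  rewrite ler_wpM2l//; apply: mulr_ge0 => //.
  by rewrite (mulr_ge0 (mulr_ge0 (mulr_ge0 (ltW D0) _) _))// powR_ge0.
rewrite /M; have -> : (2 * (2 * r) = 2 * d%:R * (2 * (r / d%:R)))%R.
  by field; rewrite gt_eqF.
rewrite (_ : (2 * d%:R * (2 * (r / d%:R))) `^ beta =
    (2 * d%:R) `^ beta * (2 * (r / d%:R)) `^ beta)%R; last first.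
  by rewrite powRM ?mulr_ge0 ?divr_ge0 ?(ltW r0).
by rewrite le_eqVlt; apply/orP; left; apply/eqP; ring.
Qed.

(** An infimum [-oo] would make the weighted integral infinite, as the weight has positive mass on
    the ball. *)
Lemma weighted_osc_lty_ess_inf f x r : (0 < r)%R -> measurable_fun (eball x r) f ->
  weighted_osc beta q w f (eball x r) < +oo -> ess_inf_on (eball x r) f \is a fin_num.
Proof.
move=> r0 mf h; rewrite fin_numE -ltey ess_inf_on_lty ?B_gt0// andbT.
apply: contraTN h => /eqP einf; rewrite -leNgt leye_eq; apply/eqP.
rewrite /weighted_osc WE// inver gt_eqF ?W0//.
rewrite lebesgue_eballE// poweR_EFin inver gt_eqF ?powR_gt0 ?vol_gt0//.
suff -> : \int[mu]_(y in eball x r)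
    (((f y)%:E - ess_inf_on (eball x r) f) `^ q * (w y `^ q)%:E) = +oo.
  rewrite gt0_muley ?lte_fin ?invr_gt0 ?W0// poweRyr ?invr_eq0 ?gt_eqF//.
  by rewrite gt0_muley ?lte_fin ?invr_gt0 ?powR_gt0 ?vol_gt0.
rewrite einf.
have mwq : measurable_fun (eball x r) (fun y => (w y `^ q)%:E).
  apply/measurable_EFinP; exact: (measurableT_comp (measurable_powR q) (mw r0)).
have fy y : (f y)%:E - -oo = +oo by [].
under eq_integral => y _ do rewrite fy poweRyr ?gt_eqF//.
rewrite ge0_integralZl//; first by rewrite WE// gt0_mulye ?lte_fin ?W0.
by move=> y _; rewrite lee_fin powR_ge0.
Qed.

(** Chain of [avg_le_dual] and [power_mean_le]; multiplying and dividing by the weighted mass of the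
    ball then separates the weighted oscillation from [weight_mean]. *)
Lemma excess_weighted_osc_le f x r : (0 < r)%R -> measurable_fun (eball x r) f ->
  ess_inf_on (eball x r) f \is a fin_num ->
  avg (eball x r) (fun y => (excess (eball x r) f y)%:E) <=
  (vol x r `^ (beta / d%:R))%:E * weighted_osc beta q w f (eball x r) *
  (weight_mean q w (eball x r) * dual_mean p w (eball x r)).
Proof.
move=> r0 mf fin; set B := eball x r.
have v0 := vol_gt0 d_gt0 x r0.
have vb : (0 < vol x r `^ (beta / d%:R))%R by rewrite powR_gt0.
have me : measurable_fun B (excess B f) by apply: measurable_excess => //; exact: mB.
have mew : measurable_fun B (fun y => excess B f y * w y)%R.
  by apply: measurable_funM => //; exact: mw.
have p0 : (0 < p)%R by exact: lt_le_trans p_ge1.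
apply: le_trans (avg_le_dual d_gt0 p_ge1 w_Apq r0 me (fun y _ => excess_ge0 _ _ _)) _.
rewrite muleA lee_wpmul2r ?(dual_mean_ge0 w_Apq)//.
apply: le_trans (power_mean_le (mB x r) (B_gt0 x r0) (lebesgue_eball_lty x r0) mew
  (fun y _ => mulr_ge0 (excess_ge0 _ _ _) (w_ge0 y)) p0 pq) _.
have i0 : 0 <= osc_int f x r by apply: integral_ge0 => y _; rewrite lee_fin powR_ge0.
rewrite weighted_oscE// !muleA -EFinM divff ?gt_eqF// mul1e /weight_mean.
rewrite !(avgE (B_gt0 x r0) (lebesgue_eball_lty x r0)) WE//.
rewrite -/(vol x r); have Wr := W0 x r0.
have c1 : 0 <= ((W x r)^-1)%:E by rewrite lee_fin invr_ge0 ltW.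
have c2 : 0 <= ((vol x r)^-1)%:E * (W x r)%:E 
  by rewrite -EFinM lee_fin mulr_ge0 ?invr_ge0 ?(ltW v0) ?(ltW Wr).
rewrite -poweRM//; last by rewrite mule_ge0.
have -> : ((W x r)^-1)%:E * osc_int f x r * (((vol x r)^-1)%:E * (W x r)%:E) =
    ((vol x r)^-1)%:E * osc_int f x r.
  rewrite muleC -muleA; congr (_ * _).
  by rewrite muleA -EFinM mulfV ?gt_eqF// mul1e.
by [].
Qed.

Lemma weighted_osc_le_osc_class (theta1 C : R) : (0 < C)%R ->
  exists2 C' : R, (0 < C')%R &
  forall f, loc_integrable f ->
    (forall x0 r, (0 < r)%R -> weighted_osc beta q w f (eball x0 r) <=
       C%:E * Apq_const rho theta2 p q w * growth rho x0 r (theta1 - theta2)) ->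
    osc_class rho beta theta1 f /\
    osc_norm rho beta theta1 f <= C'%:E * Apq_const rho theta2 p q w.
Proof.
move=> C_gt0; have Agt0 := Apq_const_gt0 d_gt0 rho_gt0 p_ge1 w_Apq.
have Afin := Apq_const_fin d_gt0 rho_gt0 p_ge1 w_Apq.
rewrite -(fineK Afin); set a := fine _.
have a0 : (0 < a)%R by rewrite -lte_fin fineK.
(* One factor [a] comes from the hypothesis and another from [le_Apq_const]; the surplus one goes
   into the constant. *)
exists (C * a)%R; first by rewrite mulr_gt0.
move=> f f_loc hf.
suff h : osc_norm rho beta theta1 f <= (C * a)%:E * a%:E.
  by split=> //; split=> //; apply: le_lt_trans h _; rewrite -EFinM ltry.
apply: ge_ereal_sup => _ [x [r [r0 /= ->]]].
have v0 := vol_gt0 d_gt0 x r0.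
have mf := measurable_fun_loc r0 f_loc.
have hx := hf x r r0; rewrite growthE -!EFinM in hx.
have fin : ess_inf_on (eball x r) f \is a fin_num.
  by apply: weighted_osc_lty_ess_inf => //; apply: le_lt_trans hx _; rewrite ltry.
rewrite growth_volE// integral_excess//.
have vb : (0 < vol x r `^ (beta / d%:R))%R by rewrite powR_gt0.
have g0 t : (0 < gr rho x r t)%R by rewrite gr_gt0// ltW.
have := excess_weighted_osc_le r0 (mf x) fin.
rewrite (avgE (B_gt0 x r0) (lebesgue_eball_lty x r0)) -/(vol x r) lee_pdivrMl// => h.
rewrite lee_pdivrMl; last by rewrite mulr_gt0 ?g0// powR_gt0.
apply: le_trans h _.
have Aprod := le_Apq_const theta2 p q w rho_gt0 x r0.
rewrite -(fineK Afin) growthE -EFinM -/a in Aprod.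
have wd0 : 0 <= weight_mean q w (eball x r) * dual_mean p w (eball x r).
  by rewrite mule_ge0 ?poweR_ge0 ?(dual_mean_ge0 w_Apq).
have wo0 : 0 <= weighted_osc beta q w f (eball x r).
  rewrite weighted_oscE// mule_ge0 ?poweR_ge0// lee_fin invr_ge0 ltW//.
apply: (@le_trans _ _ ((vol x r)%:E * ((vol x r `^ (beta / d%:R))%:E *
    (C * a * gr rho x r (theta1 - theta2))%:E * (gr rho x r theta2 * a)%:E))).
  rewrite lee_wpmul2l ?lee_fin ?(ltW v0)//; apply: lee_pmul => //.
    by rewrite mule_ge0// lee_fin ltW.
  by rewrite lee_wpmul2l// lee_fin ltW.
rewrite -!EFinM lee_fin powRD; last by apply/implyP => _; rewrite gt_eqF.
rewrite powRr1 ?(ltW v0)//.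
(* The growth exponents [theta1 - theta2] of the hypothesis and [theta2] of the weight combine to
   that of the norm. *)
rewrite [in leRHS](_ : theta1 = theta1 - theta2 + theta2)%R; last by rewrite subrK.
rewrite (grD rho_gt0 x (theta1 - theta2) theta2 (ltW r0)).
by rewrite le_eqVlt; apply/orP; left; apply/eqP; ring.
Qed.

End main.

(** The supremum is nonnegative, with default value 0 for an empty or unbounded set; the value 0
    contradicts the lower bound in [admissible_constants] at [y = x], whose middle term would be
    0. *)
Lemma critical_radius_gt0 (R : realType) (d : nat) (V : d.-tuple R -> R) (C0 N0 : R) :
  0 < C0 -> admissible_constants (critical_radius V) C0 N0 ->
  forall x, 0 < critical_radius V x.
Proof.
move=> C00 adm x; rewrite lt0r; apply/andP; split.
  have [+ _] := adm x x; apply: contraTneq => ->.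
  by rewrite !invr0 !mulr0 addr0 powR1 mulr1 -ltNge invr_gt0.
rewrite /critical_radius; set S := [set r | _].
have [[r Sr]|S0] := pselect (S !=set0); last first.
  by rewrite sup_out// => -[].
have [ubS|ubS] := pselect (has_ubound S); last by rewrite sup_out// => -[].
by apply: le_trans (ub_le_sup ubS Sr); have [/ltW] := Sr.
Qed.

Theorem theorem6p5 (R : realType) (d : nat) (hd : (3 <= d)%N)
    (V : d.-tuple R -> R) (V_ge0 : forall x, 0 <= V x)
    (V_loc : loc_integrable V)
    (V_neq0 : ~ (\forall x \ae lebesgue_tuple R d, V x = 0))
    (s : \bar R) (s_gt1 : (1 < s)%E) (s_ged2 : ((d%:R / 2)%:E <= s)%E)
    (V_RH : reverse_hoelder s V)
    (C0 N0 : R) (C0_ge1 : 1 <= C0) (N0_gt0 : 0 < N0)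
    (hC0N0 : admissible_constants (critical_radius V) C0 N0)
    (p q beta theta2 : R) (p_ge1 : 1 <= p) (pq : p < q)
    (theta2_gt0 : 0 < theta2) (beta_gt0 : 0 < beta) (beta_lt1 : beta < 1)
    (w : d.-tuple R -> R)
    (w_Apq : Apq_class (critical_radius V) theta2 p q w) :
  (forall theta1 : R, 0 < theta1 ->
    exists2 C : R, 0 < C &
    forall f : d.-tuple R -> R, osc_class (critical_radius V) beta theta1 f ->
    forall (x0 : d.-tuple R) (r : R), 0 < r ->
      (weighted_osc beta q w f (eball x0 r) <=
       C%:E * Apq_const (critical_radius V) theta2 p q w *
       growth (critical_radius V) x0 r ((N0 + 1) * theta1) *
       osc_norm (critical_radius V) beta theta1 f)%E)
  /\
  (forall (theta1 C : R), 0 < theta1 -> 0 < C ->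
    exists2 C' : R, 0 < C' &
    forall f : d.-tuple R -> R, loc_integrable f ->
      (forall (x0 : d.-tuple R) (r : R), 0 < r ->
        (weighted_osc beta q w f (eball x0 r) <=
         C%:E * Apq_const (critical_radius V) theta2 p q w *
         growth (critical_radius V) x0 r (theta1 - theta2))%E) ->
      osc_class (critical_radius V) beta theta1 f /\
      (osc_norm (critical_radius V) beta theta1 f <=
       C'%:E * Apq_const (critical_radius V) theta2 p q w)%E).
Proof.
have d_gt0 : (0 < d)%N by exact: leq_trans hd.
have rho_gt0 := critical_radius_gt0 (lt_le_trans ltr01 C0_ge1) hC0N0.
split=> [theta1 t10|theta1 C t10 C_gt0]; last first.
  exact: (weighted_osc_le_osc_class d_gt0 beta rho_gt0 p_ge1 pq w_Apq theta1 C_gt0).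
have [C C_gt0 hC] := osc_class_weighted_osc_le d_gt0 rho_gt0 p_ge1 pq beta_gt0
  w_Apq C0_ge1 N0_gt0 (ltW t10) hC0N0.
have Agt0 := Apq_const_gt0 d_gt0 rho_gt0 p_ge1 w_Apq.
have Afin := Apq_const_fin d_gt0 rho_gt0 p_ge1 w_Apq.
rewrite -(fineK Afin); set a := fine _.
have a0 : 0 < a by rewrite -lte_fin fineK.
(* Dividing by the positive constant of the weight makes it appear in the stated bound. *)
exists (C / a); first by rewrite divr_gt0.
move=> f f_osc x0 r r0; rewrite -EFinM divfK ?gt_eqF//; exact: hC.
Qed.
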